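(* Let $C:f=0$ be a reduced plane curve of degree $d$ in $\mathbb{P}^2$ over $\mathbb{C}$ such that $r=\mathrm{mdr}(f)$ satisfies $1\le r\le d/2$. Then the set of jumping lines for the vector bundle $E_C$ is contained in a union of at most $(d-1)^2-r(d-r-1)-\tau(C)$ lines in $\mathbb{P}(S_1)$.
   Context: $S=\mathbb{C}[x,y,z]$ with the usual grading; $f\in S_d$ is the reduced homogeneous equation of $C$; $f_x,f_y,f_z$ are its partial derivatives. $AR(f)\subset S^3$ is the graded $S$-module with $AR(f)_k=\{(a,b,c)\in S_k^3: af_x+bf_y+cf_z=0\}$ and $\mathrm{mdr}(f)=\min\{k: AR(f)_k\neq 0\}$. $E_C=\widetilde{AR(f)}$ is the associated rank two vector bundle on $\mathbb{P}^2$. For a line $L$, the integers $d_1^L\le d_2^L$ are defined by $E_C|_L\simeq\mathcal{O}_L(-d_1^L)\oplus\mathcal{O}_L(-d_2^L)$; for a generic line $L_0$ the pair $(d_1^{L_0},d_2^{L_0})$ is constant, and $L$ is a jumping line for $E_C$ if $d_1^{L_0}-d_1^L>0$. Lines $L:\alpha_L=0$ in $\mathbb{P}^2$ are identified with points $\alpha_L$ of the dual plane $\mathbb{P}(S_1)$. $\tau(C)=\sum_{p\in C}\tau(C,p)$ is the global Tjurina number of $C$. *)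

(* Defs.v *)
From HB Require Import structures.
From mathcomp Require Import all_boot all_order all_algebra.
From mathcomp Require Import boolp classical_sets cardinality fsbigop reals.
From mathcomp Require Import complex.
From mathcomp Require Import mpoly.

Set Implicit Arguments.
Unset Strict Implicit.
Unset Printing Implicit Defensive.

Import Order.TTheory GRing.Theory Num.Theory.

Local Open Scope classical_set_scope.
Local Open Scope ring_scope.

Local Notation "x %:F" := (tofrac x).

Section Curves.
Variable K : fieldType.
Local Notation S := {mpoly K[3]}.
Local Notation F := {fraction {mpoly K[3]}}.

(** S/(f) has no nonzero nilpotent element. *)
Definition reduced (f : S) : Prop :=
  f != 0 /\
  forall (h : S) (n : nat),
    (exists q : S, h ^+ n = q * f) -> exists q : S, h = q * f.

(** The homogeneous component S_k, for k in Z. *)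
Definition Sdeg (k : int) : set S :=
  [set p | match k with Posz n => p \is n.-homog | Negz _ => p = 0 end].

(** A graded submodule of a free module S^n (possibly with shifted grading),
    given by its homogeneous components. *)
Definition graded_sub (n : nat) := int -> set 'rV[S]_n.

Definition AR (f : S) : graded_sub 3 := fun k =>
  [set a | (forall i, Sdeg k (a 0 i)) /\ \sum_(i < 3) a 0 i * f^`M(i) = 0].

Definition is_mdr (f : S) (r : nat) : Prop :=
  (exists2 a, AR f r%:Z a & a != 0) /\
  forall k : nat, (exists2 a, AR f k%:Z a & a != 0) -> (r <= k)%N.

(** S(-d1) (+) S(-d2). *)
Definition twists (d1 d2 : int) : graded_sub 2 := fun k =>
  [set v | Sdeg (k - d1) (v 0 0) /\ Sdeg (k - d2) (v 0 1)].

(** The submodule l M of M, for a linear form l. *)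
Definition mul_form (n : nat) (l : S) (M : graded_sub n) : graded_sub n :=
  fun k => [set l *: w | w in M (k - 1)].

(** Sections over D+(g) of the sheaf M~ on P^2 = Proj S, for g homogeneous of
    degree e: the elements m / g^k with m in M of degree k e.  As M is torsion
    free, this degree zero localization is a subset of F^n, and restriction to
    a smaller open set is the inclusion. *)
Definition sections (n : nat) (M : graded_sub n) (e : nat) (g : S) :
    set 'rV[F]_n :=
  [set x | exists k : nat, exists2 m, M (k * e)%N%:Z m &
             x = (g%:F ^+ k)^-1 *: map_mx (@tofrac S) m].

(** Sections over D+(g) of the structure sheaf of P^2. *)
Definition functions_on (e : nat) (g : S) : set F :=
  [set c | exists k : nat, exists2 a : S, a \is (k * e)%N.-homog &
             c = a%:F / g%:F ^+ k].

(** D+(g), for g homogeneous of degree e > 0, is a basic open set; these form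
    a basis of the topology of P^2. *)
Definition basic_open (e : nat) (g : S) : Prop :=
  [/\ (0 < e)%N, g \is e.-homog & g != 0].

(** M~ and N~ have isomorphic restrictions to the line L : l = 0.  The
    restriction M~|_L is (M / l M)~, whose sections over D+(g) meeting L in
    the affine open set D+(g) /\ L are sections M modulo sections (l M).  An
    isomorphism is a family phi_g of linear bijections between these quotients,
    compatible with the restrictions from D+(g) to D+(g h).  Here phi_g is
    represented by a map on sections of M, all laws being required modulo
    sections of l N. *)
Definition iso_on_line (m n : nat) (l : S)
    (M : graded_sub m) (N : graded_sub n) : Prop :=
  exists phi : S -> 'rV[F]_m -> 'rV[F]_n,
    (forall e g, basic_open e g ->
      let M_ := sections M e g in
      let lM_ := sections (mul_form l M) e g in
      let N_ := sections N e g in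
      let lN_ := sections (mul_form l N) e g in
      [/\ forall x, M_ x -> N_ (phi g x),
          forall x y, M_ x -> M_ y ->
            lN_ (phi g (x + y) - (phi g x + phi g y)),
          forall c x, functions_on e g c -> M_ x ->
            lN_ (phi g (c *: x) - c *: phi g x),
          forall x, M_ x -> (lN_ (phi g x) <-> lM_ x)
        & forall y, N_ y -> exists2 x, M_ x & lN_ (phi g x - y)]) /\
    (forall e g e' h x, basic_open e g -> basic_open e' h ->
      sections M e g x ->
      sections (mul_form l N) (e + e')%N (g * h) (phi (g * h) x - phi g x)).

(** A line of P^2, or point of P(S_1), is given by the nonzero vector of
    coefficients of its equation. *)
Definition line_form (a : 'rV[K]_3) : S := \sum_(i < 3) a 0 i *: 'X_i.

(** E_C|_L = O_L(-d1) (+) O_L(-d2), where E_C is the sheaf AR(f)~. *)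
Definition splitting_type (f : S) (a : 'rV[K]_3) (d1 d2 : int) : Prop :=
  d1 <= d2 /\ iso_on_line (line_form a) (AR f) (twists d1 d2).

(** The splitting type on every line of some nonempty Zariski open subset
    h <> 0 of P(S_1). *)
Definition generic_splitting_type (f : S) (d1 d2 : int) : Prop :=
  exists h : S, [/\ h != 0, exists k : nat, h \is k.-homog &
    forall a : 'rV[K]_3, a != 0 -> h.@[fun i => a 0 i] != 0 ->
      splitting_type f a d1 d2].

Definition jumping_line (f : S) (a : 'rV[K]_3) : Prop :=
  exists d1 d2 e1 e2 : int,
    [/\ splitting_type f a d1 d2, generic_splitting_type f e1 e2 & 0 < e1 - d1].

Local Notation A := {mpoly K[2]}.
Local Notation A0 := (fun _ : 'I_2 => 0 : K).

(** An equation of C near p in affine coordinates centered at p: with j such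
    that p_j != 0, we set x_j = p_j and x_i = p_i + u_k for the two other
    indices i. *)
Definition local_equation (f : S) (p : 'rV[K]_3) : A :=
  let j := odflt ord0 [pick j | p 0 j != 0] in
  f \mPo [tuple (p 0 i)%:MP + (if unlift j i is Some k then 'X_k else 0) | i < 3].

(** The local ring of the affine plane at the origin, and the ideal generated
    in it by g and its partial derivatives. *)
Definition local_ring : set {fraction A} :=
  [set x | exists a s : A, s.@[A0] != 0 /\ x = a%:F / s%:F].

Definition tjurina_ideal (g : A) : set {fraction A} :=
  [set x | exists (b : {fraction A}) (c : 'I_2 -> {fraction A}),
     [/\ local_ring b, forall i, local_ring (c i)
       & x = b * g%:F + \sum_(i < 2) c i * (g^`M(i))%:F]].

(** dim_K (O / I) = n: some n elements of O form a basis modulo I. *)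
Definition is_codim (O I : set {fraction A}) (n : nat) : Prop :=
  exists w : 'I_n -> {fraction A}, (forall i, O (w i)) /\
    forall x, O x -> exists! c : {ffun 'I_n -> K},
      I (x - \sum_(i < n) ((c i)%:MP_[2])%:F * w i).

(** tau(C,p); the default value 0 of xget is for an infinite dimension, which
    does not occur when C is reduced. *)
Definition tjurina_at (f : S) (p : 'rV[K]_3) : nat :=
  xget 0%N (is_codim local_ring (tjurina_ideal (local_equation f p))).

(** The points of P^2 are the one-dimensional subspaces of K^3, a nonzero
    vector of p being vpick p. *)
Definition curve_points (f : S) : set {vspace 'rV[K]_3} :=
  [set p | \dim p = 1%N /\ f.@[fun i => (vpick p : 'rV[K]_3) 0 i] = 0].

(** tau(C). *)
Definition tjurina (f : S) : nat :=
  (\sum_(p \in curve_points f) tjurina_at f (vpick p))%N.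

End Curves.

(* Main.v *)
(** Let [rho] be a minimal syzygy, of degree [r], and put [e = d - 1 - r]. A
    syzygy [m] satisfies [rho x m = h(m) grad f], because the partial
    derivatives of a reduced [f] have no common factor, and [h(m) = 0] only for
    multiples of [rho]. This is the exact sequence
    [0 -> O(-r) -> E_C -> I_Z(-e) -> 0], where [Z] is the zero scheme of the
    section [rho] of [E_C(r)]. On a line avoiding [Z] it restricts to an
    extension of [O_L(-e)] by [O_L(-r)], which splits as [r <= e + 1]; so such a
    line is not jumping. A jumping line contains a point of [Z], hence lies on
    the line of [P(S_1)] dual to that point. The points of [Z] are counted by
    comparing, for large [k], the dimensions of [S_k / J_k] (at least the global
    Tjurina number), of [AR(f)], and of the space of the forms [h(m)], which all
    vanish on [Z]: their number is at most [(d-1)^2 - r (d-1-r) - tau(C)].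

    The splitting type [d1 <= d2] on [L] is detected by [d1] being the least
    twist [s] such that [E_C|_L(s)] has a nonzero section. *)

Require Import Defs.
From HB Require Import structures.
From mathcomp Require Import all_boot all_order all_algebra.
From mathcomp Require Import boolp classical_sets cardinality fsbigop reals.
From mathcomp Require Import complex mpoly ring zify.
Set Implicit Arguments.
Unset Strict Implicit.
Unset Printing Implicit Defensive.
Import Order.TTheory GRing.Theory Num.Theory.
Local Open Scope ring_scope.

Local Notation "x %:F" := (tofrac x).

(** * GCD domains *)

Section GcdDomains.

(** An isomorphism on a line is given by maps that are additive, linear and compatible with
    restrictions only modulo sections of [l N]. What is carried across it is the existence of a
    nonzero pair of chart sections glued by [(y1 / y0) ^ s]; on the line this becomes an identity
    between polynomials in [T = y1 / y0], and cohomology reduces to counting degrees.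

    On a line avoiding [Z] the value [d1 = min (r, e)] is exact: [rho] accounts for [r], and [e < r]
    leaves only [e = r - 1], where a section of [O_L(-e)] has to be lifted. A generic line can be
    chosen to avoid [Z] too, so the generic splitting type need not be computed separately.

    [Z] is not known to be finite beforehand. The count applies to every finite set of zeros, so a
    largest one exists, and it contains all zeros up to scalars. *)

Definition divides (R : comNzRingType) (a b : R) := exists c, b = c * a.

Definition strongly_coprime (R : comNzRingType) (q p : R) :=
  forall x, divides q (p * x) -> divides q x.

(** These are the GCD domains. *)
Definition reduced_fractions (R : idomainType) := forall p q : R, q != 0 ->
  exists g p' q', [/\ p = g * p', q = g * q' & strongly_coprime q' p'].

Lemma divides_refl (R : comNzRingType) (a : R) : divides a a.
Proof. by exists 1; rewrite mul1r. Qed.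

Lemma divides0 (R : comNzRingType) (a : R) : divides a 0.
Proof. by exists 0; rewrite mul0r. Qed.

Lemma divides_trans (R : comNzRingType) (b a c : R) :
  divides a b -> divides b c -> divides a c.
Proof. by move=> [x ->] [y ->]; exists (y * x); rewrite mulrA. Qed.

Lemma divides_mull (R : comNzRingType) (c a b : R) :
  divides a b -> divides a (c * b).
Proof. by move=> [x ->]; exists (c * x); rewrite mulrA. Qed.

Lemma divides_mulr (R : comNzRingType) (c a b : R) :
  divides a b -> divides a (b * c).
Proof. by rewrite mulrC; apply: divides_mull. Qed.

Lemma dividesB (R : comNzRingType) (a b c : R) :
  divides a b -> divides a c -> divides a (b - c).
Proof. by move=> [x ->] [y ->]; exists (x - y); rewrite mulrBl. Qed.

Lemma dividesD (R : comNzRingType) (a b c : R) :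
  divides a b -> divides a c -> divides a (b + c).
Proof. by move=> [x ->] [y ->]; exists (x + y); rewrite mulrDl. Qed.

Lemma divides_polyCP (R : idomainType) (c : R) (p : {poly R}) :
  divides c%:P p <-> forall i, divides c p`_i.
Proof.
split=> [[q ->] i|cp]; first by exists q`_i; rewrite coefMC.
have [x xP] := choice cp.
exists (\poly_(i < size p) x i); apply/polyP => i; rewrite coefMC coef_poly.
by case: ltnP => [_|h]; [exact: xP | rewrite mul0r nth_default].
Qed.

Section Content.
Variable R : idomainType.
Hypothesis redR : reduced_fractions R.

(** With [a = p1 d] and [b = q1 d], the relation [p1 q = q1 p] and coprimality give [q | q1]; the
    quotient of [q1] by [q] is that of [g] by [d]. *)
Lemma gcd_exists (a b : R) : exists g, [/\ divides g a, divides g b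
  & forall d, divides d a -> divides d b -> divides d g].
Proof.
have [->|b0] := eqVneq b 0.
  by exists a; split=> //; [exact: divides_refl | exact: divides0].
have [g [p [q [-> defb cop]]]] := redR a b0; exists g; subst b; split.
- by exists p; rewrite mulrC.
- by exists q; rewrite mulrC.
move=> d [p1 p1P] [q1 q1P].
have := b0; rewrite mulf_eq0 negb_or => /andP[g0 q0].
have d0 : d != 0 by apply: contraNneq b0 => d0; rewrite q1P d0 mulr0.
have e : p1 * q = q1 * p.
  apply: (mulIf (mulf_neq0 d0 g0)).
  transitivity ((p1 * d) * (g * q)); first by ring.
  by rewrite -p1P q1P; ring.
have [] := cop q1; first by exists p1; rewrite e mulrC.
move=> t q1t; exists t; apply: (mulIf q0).
by rewrite q1P q1t; ring.
Qed.

Lemma content_exists (s : seq R) : exists g, (forall i, divides g s`_i)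
  /\ forall d, (forall i, divides d s`_i) -> divides d g.
Proof.
elim: s => [|a s [g [gs gP]]].
  by exists 0; split=> [i|d _]; rewrite ?nth_nil; exact: divides0.
have [h [ha hg hP]] := gcd_exists a g; exists h; split.
  by case=> [|i] //=; apply: divides_trans (gs i).
move=> d dP; apply: hP; first exact: (dP 0%N).
by apply: gP => i; apply: (dP i.+1).
Qed.

Lemma lead_term_split (p : {poly R}) : p != 0 ->
  exists2 q, p = q + (lead_coef p)%:P * 'X^((size p).-1) & (size q < size p)%N.
Proof.
rewrite -size_poly_gt0 => p0; exists (\poly_(i < (size p).-1) p`_i).
  apply/polyP => i; rewrite coefD coef_poly coefCM coefXn lead_coefE.
  case: ltngtP => [h|h|->]; rewrite ?(mulr1, mulr0, addr0, add0r) //.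
  by rewrite nth_default //; case: (size p) p0 h.
by rewrite (leq_ltn_trans (size_poly _ _)) // prednK.
Qed.

(* Splitting [c = d c'] with [d = gcd (c, lead p)], the factor [c'] divides the
   leading coefficient of [y] and [d] that of [p], so that both leading terms
   can be dropped. *)
Lemma gauss_content (p y : {poly R}) (c : R) :
    (forall d, divides d c -> divides d%:P p -> d \is a GRing.unit) ->
  divides c%:P (p * y) -> divides c%:P y.
Proof.
have [n] := ubnP (size p + size y).
elim: n p y c => // n IH p y c lt_n copr [w cw].
have [->|y0] := eqVneq y 0; first exact: divides0.
have [p0|p0] := eqVneq p 0.
  have uc : c \is a GRing.unit.
    by apply: copr; [exact: divides_refl | rewrite p0; exact: divides0].
  exists (c^-1%:P * y); rewrite mulrAC -polyCM mulVr //.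
  by rewrite mul1r.
have c0 : c != 0.
  apply: contraTneq (mulf_neq0 p0 y0) => c0.
  by rewrite cw c0 polyC0 mulr0 eqxx.
have [d [a [c' [la cE cop]]]] := redR (lead_coef p) c0.
have := c0; rewrite cE mulf_eq0 negb_or => /andP[d0 c'0].
have [p1 p1E lt_p1] := lead_term_split p0.
have [y1 y1E lt_y1] := lead_term_split y0.
have c'c : divides c' c by exists d.
have c'y : divides c'%:P y.
  have c'l : divides c' (lead_coef y).
    apply: cop; exists (lead_coef w); apply: (mulfI d0).
    rewrite mulrA -la -lead_coefM cw lead_coefM lead_coefC cE; ring.
  have c'L : divides c'%:P ((lead_coef y)%:P * 'X^((size y).-1)).
    by case: c'l => t ->; exists (t%:P * 'X^((size y).-1)); rewrite polyCM; ring.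
  rewrite y1E; apply: (dividesD _ c'L).
  apply: (IH p) => [|e ec|].
  - by move: lt_n lt_y1; lia.
  - by apply: copr; apply: divides_trans c'c.
  - have -> : p * y1 = p * y - p * ((lead_coef y)%:P * 'X^((size y).-1)).
      by rewrite -mulrBr {1}y1E addrK.
    apply: dividesB; last exact: divides_mull c'L.
    by exists (w * d%:P); rewrite cw cE polyCM mulrA.
have [y2 y2E] := c'y.
have y20 : y2 != 0 by apply: contraNneq y0 => z; rewrite y2E z mul0r.
have dl : divides d%:P ((lead_coef p)%:P * 'X^((size p).-1)).
  by exists (a%:P * 'X^((size p).-1)); rewrite la polyCM; ring.
have [] := IH p1 y2 d.
- have <- : size y = size y2 by rewrite y2E mulrC mul_polyC size_scale.
  by move: lt_n lt_p1; lia.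
- move=> e ed ep; apply: copr.
    by apply: (divides_trans ed); exists c'; rewrite mulrC.
  rewrite p1E; apply: dividesD => //; apply: divides_trans dl.
  by case: ed => t ->; exists t%:P; rewrite polyCM.
- have -> : p1 * y2 = p * y2 - (lead_coef p)%:P * 'X^((size p).-1) * y2.
    by rewrite -mulrBl {1}p1E addrK.
  apply: dividesB; last exact: divides_mulr dl.
  exists w; apply: (@mulIf _ c'%:P); first by rewrite polyC_eq0.
  by rewrite -mulrA -y2E cw cE polyCM mulrA.
by move=> t tE; exists t; rewrite y2E tE polyCM mulrA.
Qed.

(** The conclusion of Gauss's lemma serves as the definition, so that contents do not reappear in
    later divisibility arguments. *)
Definition primitive_poly (p : {poly R}) :=
  forall c y, divides c%:P (p * y) -> divides c%:P y.

Lemma primitive_part (p : {poly R}) : p != 0 ->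
  exists c p', [/\ c != 0, p = c%:P * p' & primitive_poly p'].
Proof.
move=> p0; have [c [cp cP]] := content_exists p.
have [p' p'E] := (divides_polyCP c p).2 cp.
have c0 : c != 0 by apply: contraNneq p0 => c0; rewrite p'E c0 polyC0 mulr0.
exists c, p'; split=> [//||k y]; first by rewrite p'E mulrC.
apply: gauss_content => d _ /divides_polyCP dp'.
have [] := cP (c * d).
  move=> i; have [t tE] := dp' i; exists t.
  by rewrite p'E coefMC tE; ring.
move=> t tE; apply/unitrPr; exists t; apply: (mulfI c0).
by rewrite mulr1 {2}tE; ring.
Qed.

Import Pdiv.Idomain.

(** Over a domain, [%|] means [c x = q p] for some nonzero constant [c]; primitivity of [p] makes
    [c] divide [q]. *)
Lemma primitive_dvdp (p x : {poly R}) : p != 0 -> primitive_poly p ->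
  p %| x -> divides p x.
Proof.
move=> p0 pp /Pdiv.WeakIdomain.dvdpP[[c q] /= c0 e].
have [] := pp c q; first by exists x; rewrite mulrC -e -mul_polyC mulrC.
move=> t tE; exists t; apply: (@mulfI _ c%:P); first by rewrite polyC_eq0.
by rewrite mul_polyC e tE; ring.
Qed.

(** Dividing by the primitive part of [gcdp p q] leaves polynomials coprime over the fraction field.
    Their contents [a], [b] are then split off, and the fraction [a / b] is reduced in [R]. *)
Lemma reduced_fractions_poly : reduced_fractions {poly R}.
Proof.
move=> p q q0.
have [->|p0] := eqVneq p 0.
  exists q, 0, 1; split; rewrite ?mulr0 ?mulr1 // => x _.
  by exists x; rewrite mulr1.
have D0 : gcdp p q != 0 by rewrite gcdp_eq0 negb_and p0.
have [c [D [c0 DE Dp]]] := primitive_part D0.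
have D00 : D != 0 by apply: contraNneq D0 => D00; rewrite DE D00 mulr0.
have sD : D %= gcdp p q by rewrite DE mul_polyC eqp_sym eqp_scale.
have [p1 p1E] : divides D p.
  by apply: primitive_dvdp => //; rewrite (eqp_dvdl _ sD) dvdp_gcdl.
have [q1 q1E] : divides D q.
  by apply: primitive_dvdp => //; rewrite (eqp_dvdl _ sD) dvdp_gcdr.
have p10 : p1 != 0 by apply: contraNneq p0 => z; rewrite p1E z mul0r.
have q10 : q1 != 0 by apply: contraNneq q0 => z; rewrite q1E z mul0r.
(* Up to constants gcd(p1 D, q1 D) is gcd(p1, q1) D, and it has the size of [D]; so gcd(p1, q1) is
   constant. *)
have cop : coprimep p1 q1.
  have := gcdp_mul2r p1 q1 D; rewrite -p1E -q1E => /eqp_size.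
  rewrite -(eqp_size sD) size_mul ?gcdp_eq0 ?negb_and ?p10 //.
  rewrite coprimep_def; move: D00; rewrite -size_poly_gt0.
  have : (0 < size (gcdp p1 q1))%N by rewrite size_poly_gt0 gcdp_eq0 negb_and p10.
  by lia.
have [a [p2 [a0 p2E p2p]]] := primitive_part p10.
have [b [q2 [b0 q2E q2p]]] := primitive_part q10.
have [g [a' [b' [aE bE cab]]]] := redR a b0.
exists (D * g%:P), (a'%:P * p2), (b'%:P * q2); split.
- by rewrite p1E p2E aE polyCM; ring.
- by rewrite q1E q2E bE polyCM; ring.
have a'0 : a' != 0 by apply: contraNneq a0 => z; rewrite aE z mulr0.
have b'0 : b' != 0 by apply: contraNneq b0 => z; rewrite bE z mulr0.
have q20 : q2 != 0 by apply: contraNneq q10 => z; rewrite q2E z mulr0.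
move=> x [t tE].
have [y yE] : divides q2 x.
  apply: primitive_dvdp => //.
  have : q1 %| x * p1.
    rewrite q2E mul_polyC dvdpZl //.
    apply: (@dvdp_trans _ (g%:P * (b'%:P * q2) * t)).
      by rewrite dvdp_mulr // dvdp_mull // dvdp_mull.
    have -> : x * p1 = g%:P * (b'%:P * q2) * t; last exact: dvdpp.
    transitivity (g%:P * (a'%:P * p2 * x)); last by rewrite tE; ring.
    by rewrite p2E aE polyCM; ring.
  rewrite Gauss_dvdpl 1?coprimep_sym // => /(dvdp_trans _); apply.
  by rewrite q2E dvdp_mull.
rewrite yE; suff [z ->] : divides b'%:P y by exists z; ring.
apply: p2p; apply/divides_polyCP => i; apply: cab.
have : divides b'%:P (a'%:P * (p2 * y)).
  exists t; apply: (mulIf q20); rewrite -[RHS]mulrA -tE yE; ring.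
by move/divides_polyCP => /(_ i); rewrite coefCM.
Qed.

End Content.

Lemma reduced_fractions_field (K : fieldType) : reduced_fractions K.
Proof.
move=> p q q0; exists q, (p / q), 1; split; rewrite ?mulr1 //.
  by rewrite mulrC mulfVK.
by move=> x _; exists x; rewrite mulr1.
Qed.

Lemma reduced_fractions_transfer (R S : idomainType) (h : {rmorphism R -> S}) :
  bijective h -> reduced_fractions S -> reduced_fractions R.
Proof.
move=> [k hk kh] redS p q q0.
have inj : injective h := can_inj hk.
have hq0 : h q != 0 by rewrite -(rmorph0 h) (inj_eq inj).
have [g [p' [q' [pE qE cop]]]] := redS (h p) _ hq0.
exists (k g), (k p'), (k q'); split.
- by apply: inj; rewrite rmorphM !kh.
- by apply: inj; rewrite rmorphM !kh.
move=> x [t tE]; have [] := cop (h x).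
  by exists (h t); rewrite -{1}(kh p') -{1}(kh q') -!rmorphM tE.
move=> z zE; exists (k z); apply: inj.
by rewrite rmorphM !kh.
Qed.

Lemma muniX (K : fieldType) n (m : 'X_{1..n.+1}) :
  @muni n K 'X_[m] =
    'X_[[multinom m (widen_ord (leqnSn n) i) | i < n]] *: 'X^(m ord_max).
Proof. by rewrite muniE msuppX big_seq1 mcoeffX eqxx scale1r. Qed.

(** The inverse widens the coefficients and evaluates at the last variable. This is what carries the
    GCD property from [n] to [n.+1] variables. *)
Lemma muni_bij (K : fieldType) n : bijective (@muni n K).
Proof.
pose g (P : {poly {mpoly K[n]}}) := (mpwiden P).['X_ord_max].
have gE P Q : g (P + Q) = g P + g Q by rewrite /g raddfD /= hornerD.
exists g => [p|P].
  elim/mpolyind: p => [|c m p _ _ IH]; first by rewrite /g !raddf0 horner0.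
  suff X1 : g (muni (c *: 'X_[m])) = c *: 'X_[m].
    have e : g (muni (c *: 'X_[m] + p)) = g (muni (c *: 'X_[m])) + g (muni p).
      by rewrite /g muniD raddfD /= hornerD.
    exact: etrans e (congr2 +%R X1 IH).
  rewrite muniZ /g mpwidenZ hornerZ mwidenC mul_mpolyC; congr (_ *: _).
  rewrite muniX mpwidenZ rmorphXn /= mpwidenX hornerZ hornerXn mwidenX.
  rewrite mpolyXn -mpolyXD; congr 'X_[_]; apply/mnmP => i.
  rewrite mnmDE mulmnE mnm1E eq_sym; have [->|ni] := eqVneq i ord_max.
    by rewrite mnmwiden_ordmax add0n mul1n.
  have lt_i : (i < n)%N.
    have := ltn_ord i; rewrite ltnS leq_eqVlt => /orP[/eqP h|//].
    by case/eqP: ni; apply: val_inj.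
  have -> : i = widen_ord (leqnSn n) (Ordinal lt_i) by apply: val_inj.
  by rewrite mnmwiden_widen mnmE addn0.
have muX : muni ('X_ord_max : {mpoly K[n.+1]}) = 'X.
  rewrite muniX mnm1E eqxx -[RHS]scale1r; congr (_ *: _).
  rewrite -mpolyX0; congr 'X_[_]; apply/mnmP => i.
  by rewrite mnmE mnm1E mnm0E -val_eqE /= gtn_eqF.
have muw (c : {mpoly K[n]}) : muni (mwiden c) = c%:P.
  elim/mpolyind: c => [|c m p _ _ IH]; first by rewrite !raddf0.
  rewrite mwidenD muniD IH polyCD mwidenZ muniZ mwidenX muniX.
  rewrite mnmwiden_ordmax expr0 alg_polyC -mul_polyC -polyCM mul_mpolyC.
  congr ((_ *: 'X_[_])%:P + _); apply/mnmP => i.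
  by rewrite mnmE mnmwiden_widen.
elim/poly_ind: P => [|P c IH]; first by rewrite /g raddf0 horner0 muni0.
rewrite gE raddfD /= {2}/g mpwidenC hornerC muw; congr (_ + _).
by rewrite /g rmorphM /= mpwidenX hornerMX muniM IH muX.
Qed.

Lemma reduced_fractions_mpoly (K : fieldType) n :
  reduced_fractions {mpoly K[n]}.
Proof.
elim: n => [|n IH].
  apply: (@reduced_fractions_transfer _ _ (@mcoeff 0 K 0%MM)).
    by exists (@mpolyC 0 K) => p; [rewrite [RHS]nvar0_mpolyC | exact: mpolyCK].
  exact: (@reduced_fractions_field K).
apply: reduced_fractions_transfer (@muni_bij K n) _.
exact: reduced_fractions_poly.
Qed.

End GcdDomains.

(** * Homogeneous polynomials *)

Section Homogeneous.
Variables (K : numFieldType) (n : nat).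
Implicit Types (p q h : {mpoly K[n]}).

Lemma pihomogM (k b : nat) h q : q \is b.-homog ->
  pihomog mdeg (k + b) (h * q) = pihomog mdeg k h * q.
Proof.
move=> hq; elim/mpolyind: h => [|c m p _ _ IH].
  by rewrite mul0r !raddf0 mul0r.
rewrite mulrDl !raddfD /= IH mulrDl -scalerAl !linearZ /= -scalerAl.
congr (_ *: _ + _).
have hm : 'X_[m] * q \is (mdeg m + b).-homog by rewrite dhomogM // dhomogX.
rewrite pihomogX; case: eqP => [<-|/eqP ne]; first by rewrite pihomog_dE.
by rewrite mul0r (pihomog_ne0 _ hm) // eqn_add2r.
Qed.

Lemma dhomog_quotient (k b : nat) h q : q != 0 -> q \is b.-homog ->
  h * q \is (k + b).-homog -> h \is k.-homog.
Proof.
move=> q0 hq hhq; rewrite homog_piE; apply/eqP/(mulIf q0).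
by rewrite -(pihomogM _ _ hq) pihomog_dE.
Qed.

Lemma dhomog_quotient0 (c b : nat) h q : q != 0 -> q \is b.-homog ->
  (c < b)%N -> h * q \is c.-homog -> h = 0.
Proof.
move=> q0 hq lt_cb hhq; rewrite (@pihomog_partitionE _ _ mdeg (msize h) h) //.
rewrite big1 // => k _; apply: (mulIf q0); rewrite -(pihomogM _ _ hq) mul0r.
by apply: pihomog_ne0 hhq; lia.
Qed.

Lemma mderiv_homog (k : nat) i p : p \is k.+1.-homog -> p^`M(i) \is k.-homog.
Proof.
move=> /dhomogP hp; apply/dhomogP => m; rewrite mcoeff_msupp mcoeff_deriv => h.
have /hp : (m + U_(i))%MM \in msupp p.
  by rewrite mcoeff_msupp; apply: contraNneq h => ->; rewrite mul0rn.
by rewrite /= mdegD mdeg1 addn1 => -[].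
Qed.

Lemma euler_formula (k : nat) p : p \is k.-homog ->
  \sum_(i < n) 'X_i * p^`M(i) = k%:R *: p.
Proof.
move=> /dhomogP hp; rewrite [in RHS](mpolyE p) scaler_sumr.
transitivity (\sum_(i < n) \sum_(m <- msupp p) (p@_m * (m i)%:R) *: 'X_[m]).
  apply: eq_bigr => i _; rewrite {1}(mpolyE p) raddf_sum /= mulr_sumr.
  apply: eq_bigr => m _; rewrite mderivZ mderivX -!scalerAr scalerA.
  have [->|m0] := eqVneq (m i) 0%N; first by rewrite mulr0 !scale0r.
  congr (_ *: _); rewrite -mpolyXD addmC submK //.
  by rewrite lep1mP.
rewrite exchange_big /=; apply: eq_big_seq => m /hp mk.
rewrite -scaler_suml -mulr_sumr -natr_sum scalerA mulrC.
by rewrite -mk /= mdegE.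
Qed.

Lemma msize_mderiv i p : p != 0 -> (msize p^`M(i) < msize p)%N.
Proof.
move=> p0; have [->|d0] := eqVneq p^`M(i) 0.
  by rewrite msize0 lt0n msize_poly_eq0.
rewrite -(mlead_deg d0); set m := mlead _.
have : (m + U_(i))%MM \in msupp p.
  have : p^`M(i)@_m != 0 by rewrite mleadc_eq0.
  by rewrite mcoeff_msupp mcoeff_deriv; apply: contraNneq => ->; rewrite mul0rn.
by move/msize_mdeg_lt; rewrite mdegD mdeg1 addn1.
Qed.

Lemma mderiv_eq0_const p : (forall i, p^`M(i) = 0) -> p = (p@_0%MM)%:MP.
Proof.
move=> dp; apply/mpolyP => m; rewrite mcoeffC.
have [->|m0] := eqVneq m 0%MM; first by rewrite mulr1.
rewrite mulr0.
have [i mi] : exists i, m i != 0%N.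
  apply/existsP; rewrite -negb_forall; apply: contra m0 => /forallP h.
  by apply/eqP/mnmP => i; rewrite mnm0E; apply/eqP.
have := congr1 (mcoeff (m - U_(i))) (dp i).
rewrite mcoeff0 mcoeff_deriv submK ?lep1mP // => /eqP.
by rewrite mulrn_eq0 => /eqP.
Qed.

Lemma mpoly_unitP p : p \is a GRing.unit <-> msize p = 1%N.
Proof.
split=> [/unitrPr[q pq]|/eqP/msize_poly1P[c c0 ->]].
  have : p * q != 0 by rewrite pq oner_neq0.
  rewrite mulf_eq0 negb_or => /andP[p0 q0].
  have := msizeM p0 q0; rewrite pq msize1.
  move: p0 q0; rewrite -!msize_poly_eq0.
  by case: (msize p) => [|[|a]] //; case: (msize q) => [|b] //=; rewrite addnS.
apply/unitrPr; exists (c^-1)%:MP.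
by rewrite -mpolyCM mulfV.
Qed.

End Homogeneous.

(** Induction on [n]: [v] is chosen off the zeros of the leading coefficient in the last variable,
    and the value of that variable off the roots of the resulting polynomial. *)
Lemma mpoly_nonvanishing (K : numFieldType) n (p : {mpoly K[n]}) : p != 0 ->
  exists v, p.@[v] != 0.
Proof.
elim: n p => [|n IH] p p0.
  by exists (fun=> 0); move: p0; rewrite (nvar0_mpolyC p) mevalC mpolyC_eq0.
have P0 : muni p != 0.
  apply: contra p0 => /eqP e; apply/eqP/(bij_inj (muni_bij K n)).
  by rewrite e muni0.
have lP0 : lead_coef (muni p) != 0 by rewrite lead_coef_eq0.
have [v vP] := IH _ lP0.
pose P := map_poly (meval v) (muni p).
have P'0 : P != 0.
  by rewrite -lead_coef_eq0 lead_coef_map_eq.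
have [x xP] : exists x, P.[x] != 0.
  pose s := [seq i%:R : K | i <- iota 0 (size P)].
  have us : uniq s.
    by rewrite map_inj_uniq ?iota_uniq // => i j /eqP; rewrite eqr_nat => /eqP.
  have /allPn[x _ xP] : ~~ all (root P) s.
    apply/negP => h; have := max_poly_roots P'0 h us.
    by rewrite size_map size_iota ltnn.
  by exists x.
pose w (i : 'I_n.+1) := if unlift ord_max i is Some j then v j else x.
exists w; suff -> : p.@[w] = P.[x] by [].
rewrite /P {P xP P'0 lP0 vP P0 p0}; elim/mpolyind: p => [|c m p _ _ IHp].
  by rewrite muni0 !raddf0 horner0.
rewrite mevalD muniD rmorphD /= hornerD IHp; congr (_ + _).
rewrite mevalZ muniZ muniX -!mul_polyC !rmorphM /= !map_polyC /= map_polyXn.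
rewrite !hornerE /= mevalC !mevalX big_ord_recr /= mulrA; congr (_ * _ * _).
  apply: eq_bigr => i _; rewrite /w mnmE.
  have -> : widen_ord (leqnSn n) i = lift ord_max i.
    by apply: val_inj; rewrite /= /bump leqNgt ltn_ord.
  by rewrite liftK.
by rewrite /w unlift_none.
Qed.

Section Sdeg.
Variable K : numFieldType.
Implicit Types (p q h : {mpoly K[3]}) (k i j : int).

Lemma Sdeg0 k : Sdeg k (0 : {mpoly K[3]}).
Proof. by case: k => n //=; exact: dhomog0. Qed.

Lemma SdegD k p q : Sdeg k p -> Sdeg k q -> Sdeg k (p + q).
Proof. by case: k => n /=; [exact: dhomogD | move=> -> ->; rewrite addr0]. Qed.

Lemma SdegZ k (c : K) p : Sdeg k p -> Sdeg k (c *: p).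
Proof. by case: k => n /=; [exact: dhomogZ | move=> ->; rewrite scaler0]. Qed.

Lemma SdegN k p : Sdeg k p -> Sdeg k (- p).
Proof. by move=> h; rewrite -scaleN1r; exact: SdegZ. Qed.

Lemma SdegB k p q : Sdeg k p -> Sdeg k q -> Sdeg k (p - q).
Proof. by move=> hp hq; apply: SdegD => //; exact: SdegN. Qed.

Lemma SdegM i j p q : Sdeg i p -> Sdeg j q -> Sdeg (i + j) (p * q).
Proof.
have E k (x : {mpoly K[3]}) : x = 0 -> Sdeg k x by move=> ->; exact: Sdeg0.
case: i j => i [j|j] hp hq; first exact: (dhomogM hp hq).
- by apply: E; rewrite hq mulr0.
- by apply: E; rewrite hp mul0r.
- by apply: E; rewrite hp mul0r.
Qed.

Lemma Sdeg_quotient k (b : nat) h q : q != 0 -> q \is b.-homog ->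
  Sdeg (k + b%:Z) (h * q) -> Sdeg k h.
Proof.
move=> q0 hq; case: k => k; first exact: dhomog_quotient.
case e : (Negz k + b%:Z) => [c|c] /= hhq.
  by apply: (dhomog_quotient0 q0 hq _ hhq); lia.
by apply: (mulIf q0); rewrite mul0r.
Qed.

End Sdeg.

(** * Cross products and primitive vectors *)

Section Vectors.
Variable R : comNzRingType.
Implicit Types (u v w : 'rV[R]_3).

Definition o0 : 'I_3 := @Ordinal 3 0 isT.
Definition o1 : 'I_3 := @Ordinal 3 1 isT.
Definition o2 : 'I_3 := @Ordinal 3 2 isT.

Lemma sum3 (V : nmodType) (F : 'I_3 -> V) :
  \sum_(i < 3) F i = F o0 + F o1 + F o2.
Proof.
rewrite !big_ord_recl big_ord0 addr0 addrA.
by congr (F _ + F _ + F _); apply: val_inj.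
Qed.

Lemma forall3 (P : 'I_3 -> Prop) : P o0 -> P o1 -> P o2 -> forall i, P i.
Proof.
move=> P0 P1 P2 [[|[|[|i]]] lt_i] //.
- by rewrite (_ : Ordinal _ = o0) //; apply: val_inj.
- by rewrite (_ : Ordinal _ = o1) //; apply: val_inj.
- by rewrite (_ : Ordinal _ = o2) //; apply: val_inj.
Qed.

Definition cross u v : 'rV[R]_3 := \row_i
  [:: u 0 o1 * v 0 o2 - u 0 o2 * v 0 o1;
      u 0 o2 * v 0 o0 - u 0 o0 * v 0 o2;
      u 0 o0 * v 0 o1 - u 0 o1 * v 0 o0]`_i.

Definition dot u v := \sum_(i < 3) u 0 i * v 0 i.

Definition parallel u v := forall i j, u 0 i * v 0 j = u 0 j * v 0 i.

Lemma cross_eq0 u v : cross u v = 0 -> parallel v u.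
Proof.
move=> /rowP h; have := h o0; have := h o1; have := h o2.
rewrite !mxE /= => /eqP; rewrite subr_eq0 => /eqP e2.
move=> /eqP; rewrite subr_eq0 => /eqP e1 /eqP; rewrite subr_eq0 => /eqP e0.
by apply: forall3; apply: forall3; rewrite ![v _ _ * _]mulrC ?e0 ?e1 ?e2.
Qed.

(** These are the coordinates of (u x v) x w = (u.w) v - (v.w) u. In the proof the zeros are
    rewritten backwards into the two dot products. *)
Lemma cross_parallel u v w : dot u w = 0 -> dot v w = 0 ->
  parallel (cross u v) w.
Proof.
rewrite /dot !sum3 => A0 B0.
have E k (x y : R) : x - y = v 0 k * 0 - u 0 k * 0 -> x = y.
  by move=> e; apply/eqP; rewrite -subr_eq0 e !mulr0 subr0.
have h01 : cross u v 0 o0 * w 0 o1 = cross u v 0 o1 * w 0 o0.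
  by apply: (E o2); rewrite -{1}A0 -B0 !mxE /=; ring.
have h12 : cross u v 0 o1 * w 0 o2 = cross u v 0 o2 * w 0 o1.
  by apply: (E o0); rewrite -{1}A0 -B0 !mxE /=; ring.
have h20 : cross u v 0 o2 * w 0 o0 = cross u v 0 o0 * w 0 o2.
  by apply: (E o1); rewrite -{1}A0 -B0 !mxE /=; ring.
by apply: forall3; apply: forall3; rewrite ?h01 ?h12 ?h20.
Qed.

Lemma crossD u v w : cross u (v + w) = cross u v + cross u w.
Proof. by apply/rowP; apply: forall3; rewrite !mxE /=; ring. Qed.

Lemma crossZ c u v : cross u (c *: v) = c *: cross u v.
Proof. by apply/rowP; apply: forall3; rewrite !mxE /=; ring. Qed.

End Vectors.

Definition primitive_vector (R : idomainType) (v : 'rV[R]_3) :=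
  forall q, (forall i, divides q (v 0 i)) -> q \is a GRing.unit.

(** If [p / q] is the reduced form of [w_i / v_i], then [w_j q = p v_j] for all [j]; so [q] divides
    every [v_j] and is a unit. *)
Lemma parallel_primitive (R : idomainType) (w v : 'rV[R]_3) :
  reduced_fractions R -> primitive_vector v -> parallel w v ->
  exists c, w = c *: v.
Proof.
move=> redR pv wv.
have [i vi] : exists i, v 0 i != 0.
  apply/existsP; rewrite -negb_forall; apply/negP => /forallP h.
  have : (0 : R) \is a GRing.unit.
    by apply: pv => i; rewrite (eqP (h i)); exact: divides0.
  by rewrite unitr0.
have [g [p [q [wE vE cop]]]] := redR (w 0 i) _ vi.
have g0 : g != 0 by apply: contraNneq vi => g0; rewrite vE g0 mul0r.
have e j : w 0 j * q = p * v 0 j.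
  by apply: (mulfI g0); rewrite mulrCA -vE mulrA -wE mulrC wv mulrC.
have uq : q \is a GRing.unit.
  by apply: pv => j; apply: cop; exists (w 0 j).
exists (p * q^-1); apply/rowP => j.
by rewrite !mxE mulrAC -e mulrK.
Qed.

(** * Syzygies of the gradient, for a curve of degree [d.+1] whose partial derivatives have degree
    [d] *)

Section Curve.
Variables (K : numClosedFieldType) (d : nat) (f : {mpoly K[3]}).
Local Notation S := {mpoly K[3]}.
Hypothesis fd : f \is d.+1.-homog.

Definition grad : 'rV[S]_3 := \row_i f^`M(i).

Lemma AR_dot k (a : 'rV[S]_3) : AR f k a -> dot a grad = 0.
Proof.
by move=> [_ e]; rewrite /dot -[RHS]e; apply: eq_bigr => i _; rewrite mxE.
Qed.

Lemma dot_AR k (a : 'rV[S]_3) :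
  (forall i, Sdeg k (a 0 i)) -> dot a grad = 0 -> AR f k a.
Proof.
move=> h e; split=> //.
by rewrite -[RHS]e; apply: eq_bigr => i _; rewrite mxE.
Qed.

Hypothesis fred : reduced f.

(** By Euler's formula a common factor [q] divides [f = g q], and hence [q] divides [g] times each
    derivative of [q]. Write [g = t g'], [q = t q'] with coprime cofactors. As [f] divides the
    square of [t g' q'], reducedness makes [t] a unit. Then [q'] divides its own derivatives, which
    have smaller degree, so it is constant. *)
Lemma grad_primitive : primitive_vector grad.
Proof.
have [f0 fN] := fred.
move=> q qf; have {}qf i : divides q f^`M(i) by have := qf i; rewrite mxE.
have [g gE] : divides q f.
  have [t tE] : divides q (d.+1%:R *: f).
    rewrite -(euler_formula fd).
    apply: (big_ind (divides q)) => [|x y|i _]; first exact: divides0.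
      exact: dividesD.
    by apply: divides_mull.
  exists (d.+1%:R^-1 *: t); rewrite -scalerAl -tE scalerA mulVf ?scale1r //.
  by rewrite pnatr_eq0.
have q0 : q != 0 by apply: contraNneq f0 => q0; rewrite gE q0 mulr0.
have g0 : g != 0 by apply: contraNneq f0 => g0; rewrite gE g0 mul0r.
have qgq i : divides q (g * q^`M(i)).
  have := qf i; rewrite gE mderivM => h.
  rewrite -[_ * _](addKr (g^`M(i) * q)) addrC.
  apply: dividesB h _; exact/divides_mull/divides_refl.
have [t [g' [q' [gtE qtE cop]]]] := reduced_fractions_mpoly g q0.
have := q0; rewrite qtE mulf_eq0 negb_or => /andP[t0 q'0].
have := g0; rewrite gtE mulf_eq0 negb_or => /andP[_ g'0].
have ut : t \is a GRing.unit.
  have [c cE] : exists c, t * g' * q' = c * f.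
    apply: (fN _ 2%N); exists (g' * q').
    by rewrite gE gtE qtE; ring.
  apply/unitrPr; exists c.
  apply: (mulfI (mulf_neq0 (mulf_neq0 t0 g'0) q'0)).
  by rewrite mulr1 {2}cE gE gtE {1}qtE; ring.
have q'd i : q'^`M(i) = 0.
  have [w wE] : divides q' q'^`M(i).
    have [x xE] : divides q' (t * q'^`M(i)).
      have [y yE] : divides q' q^`M(i).
        apply: cop; have [y yE] := qgq i; exists y; apply: (mulfI t0).
        by rewrite mulrA -gtE yE {1}qtE; ring.
      exists (y - t^`M(i)); rewrite mulrBl -yE {1}qtE mderivM; ring.
    exists (t^-1 * x); rewrite -mulrA -xE mulrA mulVr // mul1r //.
  apply/eqP; apply: contraT => n0.
  have w0 : w != 0 by apply: contraNneq n0 => w0; rewrite wE w0 mul0r.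
  have := msize_mderiv i q'0; rewrite wE msizeM //.
  move: w0; rewrite -msize_poly_eq0.
  by case: (msize w) => // a _; rewrite addSn /= ltnNge leq_addl.
rewrite unitrM ut /=; apply/mpoly_unitP.
have := mderiv_eq0_const q'd; move: q'0 => /[swap] ->.
by rewrite mpolyC_eq0 msizeC => ->.
Qed.

(** Both syzygies are orthogonal to the primitive vector [grad f], so their cross product is a
    multiple of it. The degree of [h] is [k - e] with [e = d - r]. *)
Lemma syzygy_cross (r k : int) (rho m : 'rV[S]_3) :
    AR f r rho -> AR f k m ->
  exists2 h, Sdeg (r + k - d%:Z) h & cross rho m = h *: grad.
Proof.
move=> hr hm.
have [h hE] := parallel_primitive (@reduced_fractions_mpoly K 3)
  grad_primitive (cross_parallel (AR_dot hr) (AR_dot hm)).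
exists h => //.
have [i gi] : exists i, f^`M(i) != 0.
  apply/existsP; rewrite -negb_forall; apply/negP => /forallP h0.
  have : (0 : S) \is a GRing.unit.
    by apply: grad_primitive => i; rewrite mxE (eqP (h0 i)); exact: divides0.
  by rewrite unitr0.
apply: (Sdeg_quotient gi (mderiv_homog i fd)); rewrite subrK.
have <- : cross rho m 0 i = h * f^`M(i) by rewrite hE !mxE.
have [hr1 _] := hr; have [hm1 _] := hm.
have E (a b c e : 'I_3) :
    Sdeg (r + k) (rho 0 a * m 0 b - rho 0 c * m 0 e).
  by apply: SdegB; apply: SdegM.
by move: i {gi}; apply: forall3; rewrite mxE /=; apply: E.
Qed.

End Curve.

(** The quotient [w] of [rho] by a common factor [q] is a syzygy not known to be homogeneous. A
    nonzero homogeneous component of it is again a syzygy, of degree at least [r] by minimality;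
    this leaves degree 0 for [q]. *)
Lemma mdr_primitive (K : numClosedFieldType) (d r : nat) (f : {mpoly K[3]})
    (rho : 'rV[{mpoly K[3]}]_3) :
    f \is d.+1.-homog -> is_mdr f r -> AR f r%:Z rho -> rho != 0 ->
  primitive_vector rho.
Proof.
move=> fd [_ rmin] hrho rho0 q qrho.
have [t tE] := choice qrho.
pose w := \row_i t i.
have rhoE : rho = q *: w by apply/rowP => i; rewrite !mxE tE mulrC.
have q0 : q != 0 by apply: contraNneq rho0 => q0; rewrite rhoE q0 scale0r.
have w0 : w != 0 by apply: contraNneq rho0 => w0; rewrite rhoE w0 scaler0.
have ws : \sum_i w 0 i * f^`M(i) = 0.
  have [_ e] := hrho; apply: (mulfI q0); rewrite mulr0 -[RHS]e mulr_sumr.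
  by apply: eq_bigr => i _; rewrite mulrA rhoE !mxE.
have [i wi] : exists i, w 0 i != 0.
  apply/existsP; rewrite -negb_forall; apply: contra w0 => /forallP h.
  by apply/eqP/rowP => i; rewrite (eqP (h i)) mxE.
have [k lt_k wk] : exists2 k,
    (k < msize (w 0%R i))%N & pihomog mdeg k (w 0 i) != 0.
  apply: contrapT => hN; case/eqP: wi.
  rewrite (@pihomog_partitionE _ _ mdeg (msize (w 0 i)) (w 0 i)) //.
  apply: big1 => k _; apply/eqP; apply: contrapT => /negP nk.
  by apply: hN; exists k.
have le_rk : (r <= k)%N.
  apply: rmin; exists (\row_j pihomog mdeg k (w 0 j)); last first.
    by apply: contraNneq wk => /rowP /(_ i); rewrite !mxE => ->.
  split=> [j|]; first by rewrite mxE; exact: pihomogP.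
  have := congr1 (pihomog mdeg (k + d)) ws.
  rewrite pihomog0 raddf_sum /= => e; rewrite -[RHS]e.
  by apply: eq_bigr => j _; rewrite (pihomogM _ _ (mderiv_homog j fd)) mxE.
have sz : (msize (rho 0%R i) <= r.+1)%N.
  have [/(_ i) h _] := hrho.
  rewrite -mlead_deg; last by rewrite rhoE mxE mulf_neq0.
  rewrite (dhomog_mf h) // mlead_supp //.
  by rewrite rhoE mxE mulf_neq0.
apply/mpoly_unitP.
move: sz; rewrite rhoE mxE msizeM //.
move: q0 le_rk lt_k; rewrite -msize_poly_eq0.
case: (msize q) => [|[|a]] //=; case: (msize _) => [|b] // _ le_rk lt_k.
by rewrite addSn; lia.
Qed.

(** * Restriction to a line *)

Lemma meval_homog (K : comNzRingType) n (k : nat) (p : {mpoly K[n]}) (c : K) v :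
  p \is k.-homog -> p.@[fun i => c * v i] = c ^+ k * p.@[v].
Proof.
move=> /dhomogP hp; rewrite !mevalE mulr_sumr; apply: eq_big_seq => m /hp /= mk.
rewrite (eq_bigr (fun i => c ^+ m i * v i ^+ m i)); last first.
  by move=> i _; rewrite exprMn.
rewrite big_split /= prodrXr -mdegE mk; ring.
Qed.

Section Restriction.
Variable K : numClosedFieldType.
Local Notation S := {mpoly K[3]}.
Implicit Types (a b c u v w : 'rV[K]_3) (m : S).

(** Coordinates [b], [c], [a] of the plane, with dual basis [u], [v], [w]: the
    line [a = 0] is spanned by [u] and [v], where [b] and [c] are coordinates. *)
Definition line_frame a b c u v w :=
  [/\ [/\ dot a u = 0 & dot a v = 0], [/\ dot b u = 1 & dot b v = 0],
      [/\ dot c u = 0 & dot c v = 1]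
    & forall i j, u 0 i * b 0 j + v 0 i * c 0 j + w 0 i * a 0 j = (i == j)%:R].

Lemma line_frame_sym a b c u v w :
  line_frame a b c u v w -> line_frame a c b v u w.
Proof.
move=> [[au av] [bu bv] [cu cv] E]; split=> // i j.
by rewrite [X in X + _]addrC E.
Qed.

Lemma line_frame_exists a : a != 0 -> exists b c u v w, line_frame a b c u v w.
Proof.
move=> a0; have [i ai] : exists i, a 0 i != 0.
  apply/existsP; rewrite -negb_forall; apply: contra a0 => /forallP h.
  by apply/eqP/rowP => i; rewrite (eqP (h i)) mxE.
pose row3 (x y z : K) : 'rV[K]_3 := \row_i [:: x; y; z]`_i.
move: i ai; apply: forall3 => ai.
- exists (row3 0 1 0), (row3 0 0 1), (row3 (- a 0 o1 / a 0 o0) 1 0),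
    (row3 (- a 0 o2 / a 0 o0) 0 1), (row3 (a 0 o0)^-1 0 0).
  split; [split|split|split|apply: forall3; apply: forall3];
  by rewrite /dot ?sum3 ?mxE /=; field.
- exists (row3 1 0 0), (row3 0 0 1), (row3 1 (- a 0 o0 / a 0 o1) 0),
    (row3 0 (- a 0 o2 / a 0 o1) 1), (row3 0 (a 0 o1)^-1 0).
  split; [split|split|split|apply: forall3; apply: forall3];
  by rewrite /dot ?sum3 ?mxE /=; field.
- exists (row3 1 0 0), (row3 0 1 0), (row3 1 0 (- a 0 o0 / a 0 o2)),
    (row3 0 1 (- a 0 o1 / a 0 o2)), (row3 0 0 (a 0 o2)^-1).
  split; [split|split|split|apply: forall3; apply: forall3];
  by rewrite /dot ?sum3 ?mxE /=; field.
Qed.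

(** Restriction to the line through [u] and [v], parametrized by [u + T v]. The point [v] is at
    infinity, so a form of degree [k] gives a polynomial of degree at most [k]. *)
Definition theta u v m : {poly K} :=
  mmap (@polyC K) (fun i => (u 0 i)%:P + v 0 i *: 'X) m.

HB.instance Definition _ u v := GRing.RMorphism.copy (theta u v)
  (mmap (@polyC K) (fun i => (u 0 i)%:P + v 0 i *: 'X)).

Lemma thetaZ u v (x : K) m : theta u v (x *: m) = x *: theta u v m.
Proof. by rewrite /theta mmapZ mul_polyC. Qed.

Lemma thetaXU u v i : theta u v 'X_i = (u 0 i)%:P + v 0 i *: 'X.
Proof. by rewrite /theta mmapX mmap1U. Qed.

Lemma theta_line u v a :
  theta u v (line_form a) = (dot a u)%:P + dot a v *: 'X.
Proof.
rewrite /line_form rmorph_sum /dot [in RHS]rmorph_sum scaler_suml -big_split.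
apply: eq_bigr => i _; rewrite /= (thetaZ u v (a 0 i) 'X_i) thetaXU.
by rewrite scalerDr scalerA -mul_polyC -polyCM.
Qed.

Lemma horner_theta u v m (t : K) :
  (theta u v m).[t] = m.@[fun i => u 0 i + v 0 i * t].
Proof.
elim/mpolyind: m => [|x m p _ _ IH]; first by rewrite !raddf0 horner0.
rewrite raddfD hornerD IH mevalD /= thetaZ hornerZ mevalZ; congr (_ * _ + _).
rewrite /theta mmapX mevalX /mmap1 horner_prod; apply: eq_bigr => i _.
by rewrite horner_exp !hornerE.
Qed.

Lemma size_theta u v (k : nat) m : m \is k.-homog ->
  (size (theta u v m) <= k.+1)%N.
Proof.
move=> /dhomogP hm; rewrite /theta /mmap.
apply: (leq_trans (size_sum _ _ _)); apply/bigmax_leqP_seq => x /hm /= <- _.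
rewrite mul_polyC (leq_trans (size_scale_leq _ _)) // mdegE /mmap1.
elim/big_rec2: _ => [|i P k' _ IH]; first by rewrite size_poly1.
apply: leq_trans (size_polyMleq _ _) _.
set h := _ + _.
have sh : (size h <= 2)%N.
  rewrite (leq_trans (size_polyD _ _)) // geq_max.
  rewrite (leq_trans (size_polyC_leq1 _)) //.
  by rewrite (leq_trans (size_scale_leq _ _)) ?size_polyX.
have hA : (size (h ^+ x i) <= (x i).+1)%N.
  apply: leq_trans (size_poly_exp_leq h (x i)) _; rewrite ltnS.
  by case: (size h) sh => [|[|[|]]] //= _; rewrite ?mul1n ?mul0n.
rewrite -subn1 leq_subLR add1n; apply: leq_trans (leq_add hA IH) _.
by rewrite addSn addnS.
Qed.

Lemma line_form_homog a : line_form a \is 1.-homog.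
Proof. by apply: rpred_sum => i _; apply: rpredZ; rewrite dhomogX /= mdeg1. Qed.

Lemma line_form_eval a (x : 'rV[K]_3) : (line_form a).@[fun i => x 0 i] = dot a x.
Proof.
rewrite /line_form rmorph_sum /dot; apply: eq_bigr => i _.
by rewrite /= (mevalZ _ (a 0 i) 'X_i) mevalXU.
Qed.

Lemma mpoly_ext (p q : S) :
    (forall x : 'rV[K]_3, p.@[fun i => x 0 i] = q.@[fun i => x 0 i]) ->
  p = q.
Proof.
move=> h; apply/eqP; rewrite -subr_eq0; apply: contraT => /mpoly_nonvanishing[x].
rewrite mevalB; have := h (\row_i x i).
have E r : r.@[fun i => (\row_i x i) 0 i] = r.@[x].
  by apply: meval_eq => i; rewrite mxE.
by rewrite !E => ->; rewrite subrr eqxx.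
Qed.

Lemma line_form_neq0 b u : dot b u != 0 -> line_form b != 0.
Proof. by apply: contraNneq => b0; rewrite -line_form_eval b0 meval0. Qed.

Lemma line_form_frame_neq0 a b c u v w :
  line_frame a b c u v w -> line_form a != 0.
Proof.
move=> [[au av] [bu bv] [cu cv] E].
apply: (@line_form_neq0 _ w); apply/eqP => aw.
have : dot b u + dot c v + dot a w = 1 + 1 + 1.
  pose T i := u 0 i * b 0 i + v 0 i * c 0 i + w 0 i * a 0 i.
  transitivity (T o0 + T o1 + T o2); first by rewrite /T /dot !sum3; ring.
  by rewrite /T !E.
by rewrite bu cv aw addr0 => /eqP; rewrite -!(natrD _ 1 1) -(natrD _ 2 1) eqr_nat.
Qed.

(** The tuple [s] is the linear projection of the plane onto the line along [w]. The form [m]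
    composed with [s] vanishes because [m] vanishes on the line, and [m] is congruent to this
    composite modulo [line_form a], as ['X_i] minus its projection is [w_i] times [line_form a]. *)
Lemma theta_eq0 a b c u v w (k : nat) m : line_frame a b c u v w ->
    m \is k.-homog -> theta u v m = 0 ->
  exists2 q, Sdeg (k%:Z - 1) q & m = q * line_form a.
Proof.
move=> fr hm m0; have [[au av] [bu bv] [cu cv] E] := fr.
have a0 := line_form_frame_neq0 fr.
pose s : 3.-tuple S :=
  [tuple u 0 i *: line_form b + v 0 i *: line_form c | i < 3].
have sm : m \mPo s = 0.
  (* Multiplying by [line_form b] disposes of the points with [b = 0], which the parameter
     [T = c / b] does not reach. *)
  have b0 : line_form b != 0 by apply: (@line_form_neq0 _ u); rewrite bu oner_eq0.
  apply: (mulIf b0); rewrite mul0r; apply: mpoly_ext => x.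
  rewrite mevalM comp_mpoly_meval meval0 line_form_eval.
  have [->|bx] := eqVneq (dot b x) 0; first by rewrite mulr0.
  rewrite (_ : m.@[_] = 0) ?mul0r //.
  have := meval_homog (dot b x) (fun i => u 0 i + v 0 i * (dot c x / dot b x)) hm.
  rewrite -horner_theta m0 horner0 mulr0 => e; rewrite -[RHS]e.
  apply: meval_eq => i; rewrite tnth_mktuple mevalD !mevalZ !line_form_eval.
  by field.
have [q qE] : divides (line_form a) (m - (m \mPo s)).
  elim/mpolyind: m {hm m0 sm} => [|x m p _ _ IH].
    by rewrite raddf0 subr0; exact: divides0.
  rewrite raddfD opprD addrACA; apply: dividesD => //=.
  rewrite comp_mpolyZ -scalerBr -mul_mpolyC; apply: divides_mull.
  rewrite comp_mpolyX mpolyXE_id.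
  elim/big_rec2: _ => [|i P Q _ [t tE]]; first by rewrite subrr; exact: divides0.
  rewrite tnth_mktuple; set L := u 0 i *: _ + _.
  have [t' t'E] : divides (line_form a) ('X_i ^+ m i - L ^+ m i).
    rewrite subrXX; apply: divides_mulr.
    exists (w 0 i)%:MP; rewrite mul_mpolyC /L.
    apply: mpoly_ext => y; rewrite mevalB mevalD !mevalZ !line_form_eval mevalXU.
    suff -> : y 0 i = u 0 i * dot b y + v 0 i * dot c y + w 0 i * dot a y by ring.
    rewrite /dot !mulr_sumr -!big_split /=.
    transitivity (\sum_j (i == j)%:R * y 0 j).
      rewrite (bigD1 i) //= eqxx mul1r big1 ?addr0 // => j ji.
      by rewrite eq_sym (negbTE ji) mul0r.
    by apply: eq_bigr => j _; rewrite -E; ring.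
  exists (t' * Q + L ^+ m i * t).
  by rewrite mulrDl mulrAC -t'E -[_ * t * _]mulrA -tE; ring.
exists q; last by rewrite -qE sm subr0.
apply: (Sdeg_quotient a0 (line_form_homog a)).
by rewrite -qE sm subr0 subrK.
Qed.

End Restriction.

(** * Sections of sheaves on a line *)

Lemma scaleV_add (F : fieldType) (V : lmodType F) (a b : F) (x y : V) :
  a != 0 -> b != 0 ->
  a^-1 *: x + b^-1 *: y = (a * b)^-1 *: (b *: x + a *: y).
Proof.
move=> a0 b0; rewrite scalerDr !scalerA invfM.
by rewrite mulfVK // [_ / _ * _]mulrAC mulVf // mul1r.
Qed.

Section GradedModules.
Variables (K : numClosedFieldType) (n : nat).
Local Notation S := {mpoly K[3]}.
Local Notation F := {fraction {mpoly K[3]}}.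
Implicit Types (M : graded_sub K n) (g h : S) (x y : 'rV[F]_n).

Definition graded_module M :=
  (forall k m m', M k m -> M k m' -> M k (m + m')) /\
  (forall i k p m, Sdeg i p -> M k m -> M (i + k) (p *: m)).

Lemma mul_form_module (l : S) M :
  graded_module M -> graded_module (mul_form l M).
Proof.
move=> [MD MZ]; split=> [k _ _ [m Mm <-] [m' Mm' <-]|i k p _ pi [m Mm <-]].
  by exists (m + m'); [exact: MD | rewrite scalerDr].
exists (p *: m); first by rewrite -addrA; exact: MZ.
by rewrite !scalerA mulrC.
Qed.

Lemma module_homogZ M (i k : nat) p m : graded_module M ->
  p \is i.-homog -> M k%:Z m -> M (i + k)%N%:Z (p *: m).
Proof. by move=> [_ MZ] pi Mm; rewrite PoszD; apply: MZ. Qed.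

Lemma sections_mono M e e' g h x : graded_module M ->
    h \is e'.-homog -> h != 0 -> sections M e g x ->
  sections M (e + e') (g * h) x.
Proof.
move=> gM hh h0 [k [m Mm ->]]; exists k, (h ^+ k *: m).
  rewrite mulnDr addnC; apply: module_homogZ => //.
  by rewrite mulnC; exact: dhomogMn.
rewrite map_mxZ scalerA; congr (_ *: _).
rewrite rmorphM exprMn rmorphXn invfM /= -mulrA mulVf ?mulr1 //.
by rewrite expf_eq0 tofrac_eq0 negb_and h0 orbT.
Qed.

Lemma sectionsD M e g x y : graded_module M -> g \is e.-homog -> g != 0 ->
  sections M e g x -> sections M e g y -> sections M e g (x + y).
Proof.
move=> gM hg g0 [k [m Mm ->]] [j [m' Mm' ->]].
exists (k + j)%N, (g ^+ j *: m + g ^+ k *: m').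
  case: (gM) => MD _; apply: MD.
    rewrite mulnDl addnC; apply: module_homogZ => //.
    by rewrite mulnC; exact: dhomogMn.
  rewrite mulnDl; apply: module_homogZ => //.
  by rewrite mulnC; exact: dhomogMn.
have gX q : g%:F ^+ q != 0 by rewrite expf_neq0 // tofrac_eq0.
rewrite (scaleV_add _ _ (gX k) (gX j)) exprD map_mxD !map_mxZ !rmorphXn.
reflexivity.
Qed.

Lemma sectionsZ M e g (c : F) x : graded_module M ->
  functions_on e g c -> sections M e g x -> sections M e g (c *: x).
Proof.
move=> gM [k [a ha ->]] [j [m Mm ->]].
exists (k + j)%N, (a *: m); first by rewrite mulnDl; exact: module_homogZ.
by rewrite map_mxZ !scalerA exprD invfM; congr (_ *: _); ring.
Qed.

Lemma functions_onN1 e g : functions_on e g (- 1).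
Proof.
exists 0%N, (- 1); first by rewrite mul0n rpredN dhomog1.
by rewrite rmorphN rmorph1 expr0 divr1.
Qed.

Lemma sectionsN M e g x : graded_module M ->
  sections M e g x -> sections M e g (- x).
Proof.
move=> gM Mx; rewrite -scaleN1r; apply: sectionsZ => //.
exact: functions_onN1.
Qed.

Lemma sectionsB M e g x y : graded_module M -> g \is e.-homog -> g != 0 ->
  sections M e g x -> sections M e g y -> sections M e g (x - y).
Proof. by move=> *; apply: sectionsD => //; apply: sectionsN. Qed.

End GradedModules.

Lemma transition_identity (F : fieldType) (V : lmodType F) (a b : F) (x y : V)
    (i j J k k' : nat) : a != 0 -> b != 0 ->
  (a ^+ i * b ^+ j / (a * b) ^+ J) *: ((b ^+ k')^-1 *: x) - (a ^+ k)^-1 *: y =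
  ((a * b) ^+ (J + k' + k))^-1 *: ((a ^+ (i + k' + k) * b ^+ (j + k)) *: x
    - (a ^+ (J + k') * b ^+ (J + k' + k)) *: y).
Proof.
move=> a0 b0; rewrite scalerBr !scalerA.
have an m : a ^+ m != 0 by rewrite expf_neq0.
have bn m : b ^+ m != 0 by rewrite expf_neq0.
congr (_ *: _ - _ *: _); rewrite !exprMn !exprD.
  by field; rewrite !an !bn.
by field; rewrite !an !bn.
Qed.

Section LineSections.
Variables (K : numClosedFieldType) (u v : 'rV[K]_3) (l y0 y1 : {mpoly K[3]}).
Local Notation S := {mpoly K[3]}.
Local Notation F := {fraction {mpoly K[3]}}.
Local Notation th := (theta u v).
Hypotheses (th_l : th l = 0) (th_y0 : th y0 = 1) (th_y1 : th y1 = 'X).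
Hypotheses (hy0 : y0 \is 1.-homog) (hy1 : y1 \is 1.-homog).

(** Elements of [M] vanishing on the line lie in [l M]: [M / l M] can then be tested through
    [theta]. *)
Definition line_saturated n (M : graded_sub K n) := forall k m, M k m ->
  map_mx th m = 0 -> exists2 w, M (k - 1) w & m = l *: w.

(** The sheaf [M~(s)|_L] has a nonzero section: [m0 / y0 ^ k] and
    [m1 / y1 ^ k'] represent it on the two standard charts of [L]. *)
Definition line_section n (M : graded_sub K n) (s : int) :=
  exists (k k' J B : nat) m0 m1,
    [/\ M k%:Z m0, M k'%:Z m1, map_mx th m0 != 0, B%:Z = J%:Z + s
      & 'X^B *: map_mx th m1 = 'X^(J + k') *: map_mx th m0].

Section OneModule.
Variables (n : nat) (M : graded_sub K n).
Hypotheses (gM : graded_module M) (sM : line_saturated M).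

(** A chart section is zero on the line exactly when its numerator is: clear denominators and apply
    [th] in one direction, use saturation in the other. *)
Lemma sections_line_eq0 (e k : nat) g m : g \is e.-homog -> th g != 0 ->
    M (k * e)%N%:Z m ->
  sections (mul_form l M) e g ((g%:F ^+ k)^-1 *: map_mx (@tofrac S) m) <->
  map_mx th m = 0.
Proof.
move=> hg thg Mm; split; last first.
  by move=> /(sM Mm)[w Mw mE]; exists k, m => //; exists w.
have g0 : g != 0 by apply: contraNneq thg => ->; rewrite rmorph0.
have gF0 : g%:F != 0 by rewrite tofrac_eq0.
move=> [j [_ [w Mw <-]] /rowP e1]; apply/rowP => i.
have := e1 i; rewrite !mxE ![_^-1 * _]mulrC => /eqP.
rewrite eqr_div ?expf_neq0 // -!rmorphXn -!rmorphM tofrac_eq => /eqP e2.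
have := congr1 th e2; rewrite !rmorphM /= th_l mul0r mul0r => /eqP.
by rewrite mulf_eq0 rmorphXn expf_eq0 (negbTE thg) andbF orbF => /eqP.
Qed.

Lemma transition_function (i j J : nat) : (i + j)%N = (J * 2)%N ->
  functions_on 2 (y0 * y1) (y0%:F ^+ i * y1%:F ^+ j / (y0%:F * y1%:F) ^+ J).
Proof.
move=> ij; exists J, (y0 ^+ i * y1 ^+ j).
  have -> : (J * 2 = 1 * i + 1 * j)%N by lia.
  by rewrite dhomogM // dhomogMn.
by rewrite !rmorphM !rmorphXn.
Qed.

(** Over the overlap both chart sections get the denominator [(y0 y1) ^ (J + k' + k)]; the
    numerators are then compared on the line, where [y0 = 1] and [y1 = T], and a power of [T] is
    cancelled. *)
Lemma gluing_line_eq (i j J k k' : nat) m0 m1 : (i + j)%N = (J * 2)%N ->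
    M k%:Z m0 -> M k'%:Z m1 ->
  sections (mul_form l M) 2 (y0 * y1)
    ((y0%:F ^+ i * y1%:F ^+ j / (y0%:F * y1%:F) ^+ J)
       *: ((y1%:F ^+ k')^-1 *: map_mx (@tofrac S) m1)
     - (y0%:F ^+ k)^-1 *: map_mx (@tofrac S) m0) <->
  'X^j *: map_mx th m1 = 'X^(J + k') *: map_mx th m0.
Proof.
move=> ij Mm0 Mm1.
have y00 : y0%:F != 0.
  rewrite tofrac_eq0; apply/eqP => e; move/eqP: th_y0.
  by rewrite e raddf0 eq_sym oner_eq0.
have y10 : y1%:F != 0.
  rewrite tofrac_eq0; apply/eqP => e; move/eqP: th_y1.
  by rewrite e raddf0 eq_sym polyX_eq0.
rewrite transition_identity; [|exact: y00|exact: y10].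
pose m := (y0 ^+ (i + k' + k) * y1 ^+ (j + k)) *: m1
  - (y0 ^+ (J + k') * y1 ^+ (J + k' + k)) *: m0.
have -> : (y0%:F ^+ (i + k' + k) * y1%:F ^+ (j + k)) *: map_mx (@tofrac S) m1
  - (y0%:F ^+ (J + k') * y1%:F ^+ (J + k' + k)) *: map_mx (@tofrac S) m0
  = map_mx (@tofrac S) m.
  by rewrite map_mxB !map_mxZ !rmorphM !rmorphXn.
rewrite -rmorphM.
have hy p q : y0 ^+ p * y1 ^+ q \is (p + q).-homog.
  have -> : (p + q = 1 * p + 1 * q)%N by lia.
  by rewrite dhomogM // dhomogMn.
have Mm : M ((J + k' + k) * 2)%N%:Z m.
  have [MD _] := gM; rewrite /m -scaleNr; apply: MD.
    have -> : ((J + k' + k) * 2 = (i + k' + k) + (j + k) + k')%N by lia.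
    by apply: module_homogZ.
  have -> : ((J + k' + k) * 2 = (J + k') + (J + k' + k) + k)%N by lia.
  by apply: module_homogZ => //; rewrite rpredN.
rewrite (sections_line_eq0 _ _ Mm); first last.
- by rewrite rmorphM /= th_y0 th_y1 mul1r polyX_eq0.
- exact: (dhomogM hy0 hy1).
rewrite /m map_mxB !map_mxZ !rmorphM !rmorphXn /= th_y0 th_y1 !expr1n !mul1r.
rewrite !exprD -['X^J * 'X^k' * 'X^k]mulrC ['X^j * _]mulrC -!scalerA.
rewrite -scalerBr; split=> [/rowP e|->]; last by rewrite subrr scaler0.
apply/eqP; rewrite -subr_eq0; apply/eqP/rowP => x; have /eqP := e x.
by rewrite !mxE mulf_eq0 expf_eq0 polyX_eq0 andbF /= => /eqP.
Qed.

End OneModule.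
End LineSections.

(** Each summand on the right is the error of one law of [phi], valid only modulo [l N]: additivity,
    the two scalings, the restrictions to the overlap, and the choice of the representatives [z0],
    [z1]. *)
Lemma transition_telescope (F : fieldType) n (c : F)
    (p01 p0 p1 g0 g1 f0 f1 z0 z1 : 'rV[F]_n) :
  p01 - (c *: z1 - z0) =
  (p01 - (p1 + p0)) + (p1 - c *: g1) + (p0 - (- 1) *: g0)
  + c *: (g1 - f1) + c *: (f1 - z1) - (g0 - f0) - (f0 - z0).
Proof. by apply/rowP => i; rewrite !mxE; ring. Qed.

Section Transfer.
Variables (K : numClosedFieldType) (u v : 'rV[K]_3) (l y0 y1 : {mpoly K[3]}).
Local Notation S := {mpoly K[3]}.
Local Notation F := {fraction {mpoly K[3]}}.
Local Notation th := (theta u v).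
Hypotheses (th_l : th l = 0) (th_y0 : th y0 = 1) (th_y1 : th y1 = 'X).
Hypotheses (hy0 : y0 \is 1.-homog) (hy1 : y1 \is 1.-homog).
Variables (m n : nat) (M : graded_sub K m) (N : graded_sub K n).
Hypotheses (gM : graded_module M) (sM : line_saturated u v l M).
Hypotheses (gN : graded_module N) (sN : line_saturated u v l N).

Let y00 : y0 != 0.
Proof. by apply/eqP => e; move/eqP: th_y0; rewrite e raddf0 eq_sym oner_eq0. Qed.

Let y10 : y1 != 0.
Proof. by apply/eqP => e; move/eqP: th_y1; rewrite e raddf0 eq_sym polyX_eq0. Qed.

Let b0 : basic_open 1 y0. Proof. by split. Qed.
Let b1 : basic_open 1 y1. Proof. by split. Qed.
Let b01 : basic_open (1 + 1) (y0 * y1).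
Proof. by split=> //; [exact: dhomogM | exact: mulf_neq0]. Qed.

(** What is kept of an isomorphism: its effect on the two charts and on their overlap. The images
    may be replaced by any representatives [z0], [z1] modulo [l N], so that preimages can be treated
    like images. *)
Lemma iso_transition : iso_on_line l M N ->
  exists phi : S -> 'rV[F]_m -> 'rV[F]_n,
  [/\ forall g x, g \in [:: y0; y1] -> sections M 1 g x ->
        sections N 1 g (phi g x),
      forall g y, g \in [:: y0; y1] -> sections N 1 g y ->
        exists2 x, sections M 1 g x & sections (mul_form l N) 1 g (phi g x - y),
      forall x z, sections M 1 y0 x ->
        sections (mul_form l N) 1 y0 (phi y0 x - z) ->
        sections (mul_form l M) 1 y0 x <-> sections (mul_form l N) 1 y0 z
    & forall c x0 x1 z0 z1, functions_on 2 (y0 * y1) c ->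
        sections M 1 y0 x0 -> sections M 1 y1 x1 ->
        sections (mul_form l N) 1 y0 (phi y0 x0 - z0) ->
        sections (mul_form l N) 1 y1 (phi y1 x1 - z1) ->
        sections (mul_form l M) 2 (y0 * y1) (c *: x1 - x0) <->
        sections (mul_form l N) 2 (y0 * y1) (c *: z1 - z0)].
Proof.
have glN := mul_form_module l gN.
have transfer e g (gb : basic_open e g) (a b : 'rV[F]_n) :
    sections (mul_form l N) e g (a - b) ->
    sections (mul_form l N) e g a <-> sections (mul_form l N) e g b.
  case: gb => _ hg g0 hab; split=> h.
    rewrite -(subKr a b); exact: sectionsB h hab.
  by rewrite -(subrK b a); exact: sectionsD hab h.
move=> [phi [phiP phiR]]; exists phi; split.
- move=> g x; rewrite !inE => /orP[] /eqP ->.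
    by have [h _ _ _ _] := phiP _ _ b0; exact: h.
  by have [h _ _ _ _] := phiP _ _ b1; exact: h.
- move=> g y; rewrite !inE => /orP[] /eqP ->.
    by have [_ _ _ _ h] := phiP _ _ b0; exact: h.
  by have [_ _ _ _ h] := phiP _ _ b1; exact: h.
- move=> x z Mx hz; have [_ _ _ h _] := phiP _ _ b0.
  rewrite -(h x Mx); exact: transfer b0 _ _ hz.
move=> c x0 x1 z0 z1 cf Mx0 Mx1 hz0 hz1.
have [_ hg g0] := b01.
have [_ hD hZ hE _] := phiP _ _ b01.
have Mg0 : sections M 2 (y0 * y1) x0 by exact: (sections_mono gM hy1 y10 Mx0).
have Mg1 : sections M 2 (y0 * y1) x1.
  by rewrite mulrC; exact: (sections_mono gM hy0 y00 Mx1).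
have Mc1 : sections M 2 (y0 * y1) (c *: x1) by exact: sectionsZ.
have MN0 : sections M 2 (y0 * y1) (- 1 *: x0).
  by apply: sectionsZ => //; exact: functions_onN1.
have Mc : sections M 2 (y0 * y1) (c *: x1 - x0) by exact: sectionsB.
rewrite -(hE _ Mc); apply: transfer b01 _ _ _.
have e := transition_telescope c
  (phi (y0 * y1) (c *: x1 - x0)) (phi (y0 * y1) (-1 *: x0))
  (phi (y0 * y1) (c *: x1)) (phi (y0 * y1) x0) (phi (y0 * y1) x1)
  (phi y0 x0) (phi y1 x1) z0 z1.
rewrite e {e}.
apply: sectionsB => //; last exact: (sections_mono glN hy1 y10 hz0).
apply: sectionsB => //; last exact: (phiR _ _ _ _ _ b0 b1 Mx0).
apply: sectionsD => //; last first.
  by apply: sectionsZ => //; rewrite mulrC; exact: (sections_mono glN hy0 y00 hz1).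
apply: sectionsD => //; last first.
  by apply: sectionsZ => //; rewrite [y0 * y1]mulrC; exact: (phiR _ _ _ _ _ b1 b0 Mx1).
apply: sectionsD => //; last first.
  by apply: hZ => //; exact: functions_onN1.
apply: sectionsD => //; last exact: hZ.
by have := hD _ _ Mc1 MN0; rewrite scaleN1r.
Qed.
End Transfer.

(** The section [z] supplies a nonempty component of [N], from which 0 is obtained by scaling;
    [graded_module] does not itself assert that components contain 0. *)
Lemma sections_mul_form0 (K : numClosedFieldType) n (N : graded_sub K n) e g l z :
  graded_module N -> sections N e g z -> sections (mul_form l N) e g 0.
Proof.
move=> [_ NZ] [k [w Nw _]]; exists k, 0; last by rewrite map_mx0 scaler0.
exists (0 *: w); last by rewrite !(scaler0, scale0r).
by rewrite addrC; apply: NZ => //; exact: Sdeg0.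
Qed.

Section TransferLineSection.
Variables (K : numClosedFieldType) (u v : 'rV[K]_3) (l y0 y1 : {mpoly K[3]}).
Local Notation S := {mpoly K[3]}.
Local Notation F := {fraction {mpoly K[3]}}.
Local Notation th := (theta u v).
Hypotheses (th_l : th l = 0) (th_y0 : th y0 = 1) (th_y1 : th y1 = 'X).
Hypotheses (hy0 : y0 \is 1.-homog) (hy1 : y1 \is 1.-homog).

(** The gluing function [(y1 / y0) ^ s] is to be written [y0 ^ i y1 ^ B / (y0 y1) ^ J] with
    [i = J - s] and [B = J + s]. Enlarging [J] makes [i] a natural number. *)
Lemma line_section_exponents n (M : graded_sub K n) s :
  line_section u v M s <-> exists (i k k' J B : nat) m0 m1,
    [/\ M k%:Z m0, M k'%:Z m1, map_mx th m0 != 0,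
       B%:Z = J%:Z + s /\ (i + B = J * 2)%N
      & 'X^B *: map_mx th m1 = 'X^(J + k') *: map_mx th m0].
Proof.
split=> [[k [k' [J [B [m0 [m1 [h0 h1 h2 h3 h4]]]]]]]|]; last first.
  move=> [i [k [k' [J [B [m0 [m1 [h0 h1 h2 [h3 _] h4]]]]]]]].
  by exists k, k', J, B, m0, m1.
exists (absz (J%:Z + (absz s)%:Z - s)%R), k, k'.
exists (J + absz s)%N, (B + absz s)%N, m0, m1.
split=> //; first by split; lia.
rewrite addnAC ![(_ + absz s)%N]addnC (exprD _ _ B) (exprD _ _ (J + k')).
by rewrite -!scalerA h4.
Qed.

Variables (m n : nat) (M : graded_sub K m) (N : graded_sub K n).
Hypotheses (gM : graded_module M) (sM : line_saturated u v l M).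
Hypotheses (gN : graded_module N) (sN : line_saturated u v l N).

Let th0 : th y0 != 0. Proof. by rewrite th_y0 oner_eq0. Qed.

Lemma line_section_iso s : iso_on_line l M N ->
  line_section u v M s <-> line_section u v N s.
Proof.
move=> /(iso_transition th_y0 th_y1 hy0 hy1 gM gN)[phi [phiS phiE phi0 phiG]].
have in0 : y0 \in [:: y0; y1] by rewrite inE eqxx.
have in1 : y1 \in [:: y0; y1] by rewrite !inE eqxx orbT.
split=> /line_section_exponents[i [k [k' [J [B [m0 [m1 [h0 h1 h2 [h3 h4] h5]]]]]]]];
  apply/line_section_exponents.
- pose x0 : 'rV[F]_m := (y0%:F ^+ k)^-1 *: map_mx (@tofrac S) m0.
  pose x1 : 'rV[F]_m := (y1%:F ^+ k')^-1 *: map_mx (@tofrac S) m1.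
  have Mx0 : sections M 1 y0 x0 by exists k, m0; rewrite ?muln1.
  have Mx1 : sections M 1 y1 x1 by exists k', m1; rewrite ?muln1.
  have Nz0 := phiS _ _ in0 Mx0; have Nz1 := phiS _ _ in1 Mx1.
  have [p [n0 Nn0 z0E]] := Nz0; have [q [n1 Nn1 z1E]] := Nz1.
  have [e0 e0'] := phi0 x0 (phi y0 x0) Mx0
    ltac:(rewrite subrr; exact: sections_mul_form0 gN Nz0).
  have [e1 _] := phiG _ x0 x1 (phi y0 x0) (phi y1 x1)
    (transition_function hy0 hy1 h4) Mx0 Mx1
    ltac:(rewrite subrr; exact: sections_mul_form0 gN Nz0)
    ltac:(rewrite subrr; exact: sections_mul_form0 gN Nz1).
  exists i, p, q, J, B, n0, n1.
  have h0' : M (k * 1)%N%:Z m0 by rewrite muln1.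
  have [E0 _] := sections_line_eq0 th_l sM hy0 th0 h0'.
  have [_ E0'] := sections_line_eq0 th_l sN hy0 th0 Nn0.
  rewrite !muln1 in Nn0 Nn1.
  split=> //.
    apply: contra h2 => /eqP h2; apply/eqP/E0/e0'.
    by rewrite z0E; exact: E0'.
  apply/(gluing_line_eq th_l th_y0 th_y1 hy0 hy1 gN sN h4 Nn0 Nn1).
  rewrite -z0E -z1E; apply: e1.
  by apply/(gluing_line_eq th_l th_y0 th_y1 hy0 hy1 gM sM h4 h0 h1).
pose z0 : 'rV[F]_n := (y0%:F ^+ k)^-1 *: map_mx (@tofrac S) m0.
pose z1 : 'rV[F]_n := (y1%:F ^+ k')^-1 *: map_mx (@tofrac S) m1.
have Nz0 : sections N 1 y0 z0 by exists k, m0; rewrite ?muln1.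
have Nz1 : sections N 1 y1 z1 by exists k', m1; rewrite ?muln1.
have [x0 Mx0 xz0] := phiE _ _ in0 Nz0; have [x1 Mx1 xz1] := phiE _ _ in1 Nz1.
have [e0 _] := phi0 _ _ Mx0 xz0.
have [_ e1] := phiG _ _ _ _ _ (transition_function hy0 hy1 h4) Mx0 Mx1 xz0 xz1.
have [p [n0 Mn0 x0E]] := Mx0; have [q [n1 Mn1 x1E]] := Mx1.
exists i, p, q, J, B, n0, n1.
have h0' : N (k * 1)%N%:Z m0 by rewrite muln1.
have [E0 _] := sections_line_eq0 th_l sN hy0 th0 h0'.
have [_ E0'] := sections_line_eq0 th_l sM hy0 th0 Mn0.
rewrite !muln1 in Mn0 Mn1.
split=> //.
  apply: contra h2 => /eqP h2; apply/eqP/E0/e0.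
  by rewrite x0E; exact: E0'.
apply/(gluing_line_eq th_l th_y0 th_y1 hy0 hy1 gM sM h4 Mn0 Mn1).
rewrite -x0E -x1E; apply: e1.
by apply/(gluing_line_eq th_l th_y0 th_y1 hy0 hy1 gN sN h4 h0 h1).
Qed.

End TransferLineSection.

(** * Reading the splitting type from sections on the line *)

Section SplittingType.
Variable K : numClosedFieldType.
Local Notation S := {mpoly K[3]}.

Lemma size_XnM (n : nat) (p : {poly K}) : p != 0 ->
  size ('X^n * p) = (n + size p)%N.
Proof. by move=> p0; rewrite size_monicM ?monicXn // size_polyXn. Qed.

Lemma size_theta_Sdeg u v k (m : S) : Sdeg k m -> theta u v m != 0 ->
  (size (theta u v m))%:Z <= k + 1.
Proof.
case: k => k /= hm; last by rewrite hm rmorph0 eqxx.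
by rewrite (_ : k%:Z + 1 = k.+1%:Z) ?lez_nat ?size_theta //; lia.
Qed.

Lemma theta_eq0_Sdeg a b c u v w k (m : S) : line_frame a b c u v w ->
    Sdeg k m -> theta u v m = 0 ->
  exists2 q, Sdeg (k - 1) q & m = line_form a * q.
Proof.
move=> fr; case: k => k hm m0.
  by have [q hq ->] := theta_eq0 fr hm m0; exists q => //; rewrite mulrC.
by exists 0; [exact: Sdeg0 | rewrite mulr0].
Qed.

Lemma row_lines_saturated n a b c u v w (k : 'I_n -> int) (m : 'rV[S]_n) :
    line_frame a b c u v w -> (forall i, Sdeg (k i) (m 0 i)) ->
    map_mx (theta u v) m = 0 ->
  exists2 q : 'rV[S]_n, forall i, Sdeg (k i - 1) (q 0 i) & m = line_form a *: q.
Proof.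
move=> fr hm /rowP m0.
have ex i : exists q, Sdeg (k i - 1) q /\ m 0 i = line_form a * q.
  have [|q] := theta_eq0_Sdeg fr (hm i); first by have := m0 i; rewrite !mxE.
  by exists q.
have [q qP] := choice ex; exists (\row_i q i).
  by move=> i; rewrite mxE; have [] := qP i.
by apply/rowP => i; rewrite !mxE; have [_ ->] := qP i.
Qed.

Lemma AR_module f : graded_module (@AR K f).
Proof.
split=> [k m m' [hm em] [hm' em']|i k p m hp [hm em]]; split.
- by move=> j; rewrite mxE; apply: SdegD.
- rewrite (eq_bigr (fun j => m 0 j * f^`M(j) + m' 0 j * f^`M(j))).
    by rewrite big_split /= em em' addr0.
  by move=> j _; rewrite mxE mulrDl.
- by move=> j; rewrite mxE; apply: SdegM.
- rewrite (eq_bigr (fun j => p * (m 0 j * f^`M(j)))).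
    by rewrite -mulr_sumr em mulr0.
  by move=> j _; rewrite mxE mulrA.
Qed.

Lemma AR_saturated a b c u v w f : line_frame a b c u v w ->
  line_saturated u v (line_form a) (@AR K f).
Proof.
move=> fr k m [hm em] m0.
have [q hq mE] := row_lines_saturated fr hm m0; exists q => //; split=> //.
have a0 := line_form_frame_neq0 fr.
apply: (mulfI a0); rewrite mulr0 -[RHS]em mulr_sumr.
by apply: eq_bigr => i _; rewrite mE mxE mulrA.
Qed.

Lemma twists_module d1 d2 : graded_module (@twists K d1 d2).
Proof.
split=> [k m m' [h0 h1] [h0' h1']|i k p m hp [h0 h1]]; split; rewrite mxE.
- exact: SdegD.
- exact: SdegD.
- by rewrite -addrA; exact: SdegM.
- by rewrite -addrA; exact: SdegM.
Qed.

Lemma forall2 (P : 'I_2 -> Prop) : P 0 -> P 1 -> forall i, P i.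
Proof.
move=> P0 P1 [[|[|i]] lt_i] //.
- by rewrite (_ : Ordinal _ = 0) //; apply: val_inj.
- by rewrite (_ : Ordinal _ = 1) //; apply: val_inj.
Qed.

Lemma twists_saturated a b c u v w d1 d2 : line_frame a b c u v w ->
  line_saturated u v (line_form a) (@twists K d1 d2).
Proof.
move=> fr k m [h0 h1] m0.
pose D (i : 'I_2) := if i == 0 then d1 else d2.
have hm i : Sdeg (k - D i) (m 0 i) by move: i; apply: forall2.
have [q hq mE] := row_lines_saturated fr hm m0; exists q => //.
by split; rewrite addrAC; [exact: (hq 0) | exact: (hq 1)].
Qed.

Section Frame.
Variables (a b c u v w : 'rV[K]_3).
Hypothesis fr : line_frame a b c u v w.

Lemma theta_frame : [/\ theta u v (line_form a) = 0,
  theta u v (line_form b) = 1 & theta u v (line_form c) = 'X].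
Proof.
have [[au av] [bu bv] [cu cv] _] := fr.
rewrite !theta_line au av bu bv cu cv !scale0r scale1r polyC0 polyC1.
by rewrite !addr0 add0r.
Qed.

Lemma line_section_twists d1 d2 : line_section u v (@twists K d1 d2) d1.
Proof.
have [_ tb tc] := theta_frame.
(* The section is the generator 1 of the first summand. It is written [y ^ q / y ^ |d1|] on both
   charts, the shift by [|d1|] keeping all exponents natural. *)
pose q := absz ((absz d1)%:Z - d1)%R.
have qE : q%:Z = (absz d1)%:Z - d1 by rewrite /q; lia.
pose m (y : S) : 'rV[S]_2 := \row_i if i == 0 then y ^+ q else 0.
have hm (x : 'rV[K]_3) : twists d1 d2 (absz d1)%:Z (m (line_form x)).
  split; rewrite mxE /=; last exact: Sdeg0.
  by rewrite -qE /=; have := dhomogMn q (line_form_homog x); rewrite mul1n.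
exists (absz d1), (absz d1), (absz d1), (absz ((absz d1)%:Z + d1)%R).
exists (m (line_form b)), (m (line_form c)).
split; [exact: hm | exact: hm | | |]; first last.
- apply/rowP => i; rewrite !mxE; case: ifP => _; last by rewrite rmorph0 !mulr0.
  rewrite !rmorphXn /= tb tc expr1n mulr1 -exprD; congr ('X^_).
  by rewrite -[LHS]/(_ + _)%N; lia.
- by lia.
apply/eqP => /rowP/(_ 0); rewrite !mxE eqxx rmorphXn /= tb expr1n => /eqP.
by rewrite oner_eq0.
Qed.

(** A nonzero coordinate in [S(-D)] is a nonzero section of [O_L(s - D)]; comparing sizes in the
    gluing identity gives [s >= D >= d1]. *)
Lemma line_section_twists_ge d1 d2 s : d1 <= d2 ->
  line_section u v (@twists K d1 d2) s -> d1 <= s.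
Proof.
move=> d12 [k [k' [J [B [m0 [m1 [[h00 h01] [h10 h11] nz sE e]]]]]]].
have key (i : 'I_2) (D : int) : d1 <= D -> Sdeg (k%:Z - D) (m0 0 i) ->
    Sdeg (k'%:Z - D) (m1 0 i) -> theta u v (m0 0 i) != 0 -> d1 <= s.
  move=> dD h0 h1 n0; have := congr1 (fun x : 'rV_2 => x 0 i) e; rewrite !mxE => e'.
  have n1 : theta u v (m1 0 i) != 0.
    apply: contraNneq n0 => z; move/eqP: e'; rewrite z mulr0 eq_sym mulf_eq0.
    by rewrite expf_eq0 polyX_eq0 andbF /= => /eqP ->.
  have := congr1 (fun p : {poly K} => size p) e'; rewrite /= !size_XnM // => se.
  have := size_theta_Sdeg h1 n1; have : (0 < size (theta u v (m0 0%R i)))%N.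
    by rewrite size_poly_gt0.
  move: se; set p0 := theta u v (m0 0%R i); set p1 := theta u v (m1 0%R i).
  by move: (size p0) (size p1) sE dD => *; lia.
have [z0|n0] := eqVneq (theta u v (m0 0 0)) 0; last exact: (key _ _ _ h00 h10).
apply: (key _ _ d12 h01 h11); apply: contraNneq nz => z1.
by apply/eqP/rowP; apply: forall2; rewrite !mxE.
Qed.

Lemma splitting_type_line_section f d1 d2 : splitting_type f a d1 d2 ->
  line_section u v (AR f) d1 /\
  forall s, line_section u v (AR f) s -> d1 <= s.
Proof.
move=> [d12 iso]; have [ta tb tc] := theta_frame.
have E s := line_section_iso ta tb tc (line_form_homog b) (line_form_homog c)
  (AR_module f) (AR_saturated (f := f) fr) (twists_module d1 d2)
  (twists_saturated (d1 := d1) (d2 := d2) fr) s iso.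
split; first by apply/E; exact: line_section_twists.
by move=> s /E; exact: line_section_twists_ge.
Qed.

End Frame.
End SplittingType.

(** * Splitting on the lines avoiding the zeros of the section *)

Lemma cross_map (R R' : comNzRingType) (h : {rmorphism R -> R'})
  (x y : 'rV[R]_3) : map_mx h (cross x y) = cross (map_mx h x) (map_mx h y).
Proof. by apply/rowP; apply: forall3; rewrite !mxE /= rmorphB !rmorphM. Qed.

Lemma scale_row_inj (R : idomainType) n (v : 'rV[R]_n) (x y : R) : v != 0 ->
  x *: v = y *: v -> x = y.
Proof.
move=> v0 /rowP e; have [i vi] : exists i, v 0 i != 0.
  apply/existsP; rewrite -negb_forall; apply: contra v0 => /forallP h.
  by apply/eqP/rowP => i; rewrite (eqP (h i)) mxE.
by apply: (mulIf vi); have := e i; rewrite !mxE.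
Qed.

Lemma crossB (R : comNzRingType) (x y z : 'rV[R]_3) :
  cross x (y - z) = cross x y - cross x z.
Proof. by rewrite crossD -[- z]scaleN1r crossZ scaleN1r. Qed.

Section JumpingLines.
Variables (K : numClosedFieldType) (d r : nat) (f : {mpoly K[3]}).
Local Notation S := {mpoly K[3]}.
Hypotheses (fd : f \is d.+1.-homog) (fred : reduced f).
Variable rho : 'rV[S]_3.
Hypotheses (fr : is_mdr f r) (rho_r : AR f r%:Z rho) (rho0 : rho != 0).

(** [rho] is a section of [E_C(r)]; its zeros are those of the forms [h] with
    [rho x m = h grad f] for some syzygy [m]. *)
Definition section_zero (p : 'rV[K]_3) := forall (k : nat) (m : 'rV[S]_3) h,
  AR f k%:Z m -> cross rho m = h *: grad f -> h.@[fun i => p 0 i] = 0.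

Lemma grad_neq0 : grad f != 0.
Proof.
apply/eqP => g0; have : (0 : S) \is a GRing.unit.
  by apply: (grad_primitive fd fred) => i; rewrite g0 mxE; exact: divides0.
by rewrite unitr0.
Qed.

Lemma syzygy_quotient_Sdeg (k : nat) (m : 'rV[S]_3) h : AR f k%:Z m ->
  cross rho m = h *: grad f -> Sdeg (r%:Z + k%:Z - d%:Z) h.
Proof.
move=> hm e; have [h' hh' e'] := syzygy_cross fd fred rho_r hm.
by rewrite (scale_row_inj grad_neq0 (etrans (esym e) e')).
Qed.

Lemma mdr_multiple (j : int) (m : 'rV[S]_3) : (forall i, Sdeg j (m 0 i)) ->
  cross rho m = 0 -> exists2 c, Sdeg (j - r%:Z) c & m = c *: rho.
Proof.
move=> hm /cross_eq0 par.
have [c cE] := parallel_primitive (@reduced_fractions_mpoly K 3)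
  (mdr_primitive fd fr rho_r rho0) par.
exists c => //; have [i ri] : exists i, rho 0 i != 0.
  apply/existsP; rewrite -negb_forall; apply: contra rho0 => /forallP h.
  by apply/eqP/rowP => i; rewrite (eqP (h i)) mxE.
have [/(_ i) hr _] := rho_r.
apply: (Sdeg_quotient ri hr); rewrite subrK.
by have := hm i; rewrite cE !mxE.
Qed.

Section Line.
Variables (a b c u v w : 'rV[K]_3).
Hypothesis frame : line_frame a b c u v w.
Local Notation th := (theta u v).
Local Notation y0 := (line_form b).
Local Notation y1 := (line_form c).

Lemma homogXn (x : 'rV[K]_3) q : line_form x ^+ q \is q.-homog.
Proof. by have := dhomogMn q (line_form_homog x); rewrite mul1n. Qed.

(** Homogenization with [y0] and [y1]: restriction from forms of degree [k] to polynomials of degree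
    at most [k] is surjective. *)
Lemma theta_lift (k : int) (P : {poly K}) : (size P)%:Z <= k + 1 ->
  exists2 h, Sdeg k h & th h = P.
Proof.
have [_ tb tc] := theta_frame frame; case: k => k sP; last first.
  exists 0; first exact: Sdeg0.
  rewrite rmorph0; apply/esym/eqP; rewrite -size_poly_eq0.
  by move: (size P) sP; lia.
exists (\sum_(i < k.+1) P`_i *: (y0 ^+ (k - i) * y1 ^+ i)).
  apply: rpred_sum => i _; apply: rpredZ.
  by have := dhomogM (homogXn b (k - i)) (homogXn c i); rewrite subnK // -ltnS.
have PE : P = \poly_(i < k.+1) P`_i.
  apply/polyP => i; rewrite coef_poly; case: ltnP => // ki.
  by rewrite nth_default // (leq_trans _ ki) //; move: (size P) sP; lia.
rewrite [RHS]PE poly_def rmorph_sum; apply: eq_bigr => i _ /=.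
by rewrite thetaZ rmorphM !rmorphXn /= tb tc expr1n mul1r.
Qed.

(** Otherwise [line_form a] would be a common factor, and it is not a unit since [th] kills it. *)
Lemma theta_neq0_mx (x : 'rV[S]_3) (k : int) : primitive_vector x ->
  (forall i, Sdeg k (x 0 i)) -> map_mx th x != 0.
Proof.
move=> px hx; apply/eqP => x0.
have [q hq xE] := row_lines_saturated frame hx x0.
have : line_form a \is a GRing.unit.
  by apply: px => i; rewrite xE mxE; exists (q 0 i); rewrite mulrC.
have [ta _ _] := theta_frame frame.
move=> /(rmorph_unit (theta u v)) /=.
by rewrite ta unitr0.
Qed.

Hypothesis avoid : forall p : 'rV[K]_3, p != 0 -> dot a p = 0 -> ~ section_zero p.

Definition quotient_on_line (P : {poly K}) := exists (k : nat) (m : 'rV[S]_3) h,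
  [/\ AR f k%:Z m, cross rho m = h *: grad f & th h = P].

Lemma ARZ i k p (m : 'rV[S]_3) : Sdeg i p -> AR f k m -> AR f (i + k) (p *: m).
Proof. by have [_] := AR_module f; apply. Qed.

Lemma ARD k (m m' : 'rV[S]_3) : AR f k m -> AR f k m' -> AR f k (m + m').
Proof. by have [+ _] := AR_module f; apply. Qed.

Lemma quotient_on_lineM P Q : quotient_on_line P -> quotient_on_line (Q * P).
Proof.
move=> [k [m [h [hm e <-]]]].
have [q hq <-] : exists2 q, Sdeg (size Q)%:Z q & th q = Q.
  by apply: theta_lift; rewrite lerDl.
exists (size Q + k)%N, (q *: m), (q * h); split; first by rewrite PoszD; apply: ARZ.
  by rewrite crossZ e scalerA.
by rewrite rmorphM.
Qed.

Lemma quotient_on_lineD P Q :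
  quotient_on_line P -> quotient_on_line Q -> quotient_on_line (P + Q).
Proof.
have [_ tb tc] := theta_frame frame.
move=> [k [m [h [hm e <-]]]] [k' [m' [h' [hm' e' <-]]]].
(* Powers of [y0], which restrict to 1, bring both syzygies to the same degree. *)
exists (k + k')%N, (y0 ^+ k' *: m + y0 ^+ k *: m'), (y0 ^+ k' * h + y0 ^+ k * h').
split.
- apply: ARD; last by rewrite PoszD; apply: ARZ => //; exact: homogXn.
  by rewrite PoszD addrC; apply: ARZ => //; exact: homogXn.
- by rewrite crossD !crossZ e e' !scalerA scalerDl.
by rewrite rmorphD !rmorphM !rmorphXn /= tb !expr1n !mul1r.
Qed.

(* The values form an ideal of [K[T]] without zeros. *)
Lemma quotient_on_line1 : quotient_on_line 1.
Proof.
have [[au av] [bu bv] _ _] := frame.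
pose has_size n := `[< exists2 P, quotient_on_line P & P != 0 /\ size P = n >].
(* A common root [t] of the values would make [u + t v] a zero of the section on the line; this
   vector is nonzero since [b] takes the value 1 on it. *)
have zeroP (t : K) : (forall P, quotient_on_line P -> P.[t] = 0) -> False.
  move=> ht; apply: (avoid (p := u + t *: v)).
  - apply/eqP => e; have : dot b (u + t *: v) = 1.
      have : dot b u + t * dot b v = 1 by rewrite bu bv mulr0 addr0.
      by rewrite /dot !sum3 !mxE => <-; ring.
    by rewrite e /dot !sum3 !mxE !mulr0 !addr0 => /esym/eqP; rewrite oner_eq0.
  - have : dot a u + t * dot a v = 0 by rewrite au av mulr0 addr0.
    by rewrite /dot !sum3 !mxE => <-; ring.
  move=> k m h hm e; have hth : quotient_on_line (th h) by exists k, m, h.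
  have := ht _ hth.
  rewrite horner_theta => e0; rewrite -[RHS]e0; apply: meval_eq => i.
  by rewrite !mxE mulrC.
have ex_size : exists n, has_size n.
  apply: contrapT => hN; apply: (zeroP 0) => P hP.
  have [->|P0] := eqVneq P 0; first by rewrite horner0.
  by case: hN; exists (size P); apply/asboolP; exists P.
case: (ex_minnP ex_size) => n /asboolP[P hP [P0 sP]] nmin.
have [s1|s1] := eqVneq (size P) 1%N.
  have /size_poly1P[x x0 PE] := introT eqP s1.
  have := quotient_on_lineM (x^-1)%:P hP.
  by rewrite PE -polyCM mulVf.
have [t tP] := closed_rootP P s1.
case: (zeroP t) => Q hQ.
rewrite (divp_eq Q P) hornerD hornerM (rootP tP) mulr0 add0r.
have [->|m0] := eqVneq (Q %% P) 0; first by rewrite horner0.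
have : has_size (size (Q %% P)).
  apply/asboolP; exists (Q %% P) => //.
  have -> : Q %% P = Q + (- (Q %/ P)) * P by rewrite {2}(divp_eq Q P); ring.
  by apply: quotient_on_lineD => //; exact: quotient_on_lineM.
by move=> /nmin; rewrite leqNgt -sP ltn_modp P0.
Qed.
End Line.

Section LineBounds.
Variables (a b c u v w : 'rV[K]_3).
Hypothesis frame : line_frame a b c u v w.
Local Notation th := (theta u v).
Hypothesis avoid : forall p : 'rV[K]_3, p != 0 -> dot a p = 0 -> ~ section_zero p.

Let th_rho : map_mx th rho != 0.
Proof.
have [hr _] := rho_r.
exact: (theta_neq0_mx frame (mdr_primitive fd fr rho_r rho0) hr).
Qed.

Let th_grad : map_mx th (grad f) != 0.
Proof.
apply: (theta_neq0_mx frame (k := d%:Z) (grad_primitive fd fred)) => i.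
by rewrite mxE; exact: mderiv_homog.
Qed.

Lemma quotient_eq1 : exists (k q : nat) (m : 'rV[S]_3) h,
  [/\ AR f k%:Z m, cross rho m = h *: grad f, th h = 1
    & q%:Z = r%:Z + k%:Z - d%:Z].
Proof.
have [k [m [h [hm e h1]]]] := quotient_on_line1 frame avoid.
exists k, (absz (r%:Z + k%:Z - d%:Z)%R), m, h; split=> //.
have := syzygy_quotient_Sdeg hm e; case: (r%:Z + k%:Z - d%:Z) => // j h0.
by move/eqP: h1; rewrite h0 rmorph0 eq_sym oner_eq0.
Qed.

(** The other chart: in the frame with [b] and [c] exchanged, [h] restricts to 1. So [h] agrees on
    the line with the [q]-th power of [line_form c], which is ['X^q] in the original parameter. *)
Lemma quotient_eqXn : exists (k q : nat) (m : 'rV[S]_3) h,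
  [/\ AR f k%:Z m, cross rho m = h *: grad f, th h = 'X^q
    & q%:Z = r%:Z + k%:Z - d%:Z].
Proof.
have [k [m [h [hm e h1]]]] := quotient_on_line1 (line_frame_sym frame) avoid.
have hh := syzygy_quotient_Sdeg hm e.
have [_ _ tc] := theta_frame frame.
have [ta' tc' _] := theta_frame (line_frame_sym frame).
exists k, (absz (r%:Z + k%:Z - d%:Z)%R), m, h; split=> //; last first.
  move: hh; case: (r%:Z + k%:Z - d%:Z) => // j h0.
  by move/eqP: h1; rewrite h0 rmorph0 eq_sym oner_eq0.
move: hh; case: (r%:Z + k%:Z - d%:Z) => q hh; last first.
  by move/eqP: h1; rewrite hh rmorph0 eq_sym oner_eq0.
have hd : Sdeg q%:Z (h - line_form c ^+ q) by apply: SdegB => //; exact: homogXn.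
have [|p _ pE] := theta_eq0_Sdeg (line_frame_sym frame) hd.
  by rewrite rmorphB rmorphXn /= h1 tc' expr1n subrr.
have [ta _ _] := theta_frame frame.
have := congr1 th pE; rewrite rmorphB rmorphM /= ta mul0r => /eqP.
by rewrite subr_eq0 rmorphXn /= tc => /eqP.
Qed.

(* If [h(m) = 0] on the line, then [h0 m - h(m) m0] is a multiple of [rho]. *)
Lemma quotient0_multiple (k k0 : nat) (m m0 : 'rV[S]_3) h h0 :
    AR f k%:Z m -> AR f k0%:Z m0 -> cross rho m = h *: grad f ->
    cross rho m0 = h0 *: grad f -> th h = 0 ->
  exists2 x, Sdeg (k%:Z + k0%:Z - d%:Z) x &
    th h0 *: map_mx th m = th x *: map_mx th rho.
Proof.
move=> hm hm0 e e0 z.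
have hh := syzygy_quotient_Sdeg hm e; have hh0 := syzygy_quotient_Sdeg hm0 e0.
have [i||x hx xE] := @mdr_multiple (r%:Z + k%:Z + k0%:Z - d%:Z) (h0 *: m - h *: m0).
- have [hm1 _] := hm; have [hm01 _] := hm0; rewrite !mxE; apply: SdegB.
    by have := SdegM hh0 (hm1 i); congr Sdeg; lia.
  by have := SdegM hh (hm01 i); congr Sdeg; lia.
- by rewrite crossB !crossZ e e0 !scalerA mulrC subrr.
exists x; first by move: hx; congr Sdeg; lia.
have := congr1 (map_mx th) xE.
by rewrite map_mxB !map_mxZ /= z scale0r subr0.
Qed.

(** A section either has a nonzero image in [O_L(s - e)], whence [s >= e = d - r], or comes from
    [O_L(s - r)], whence [s >= r]. In the second case the coefficients of [rho] on the two charts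
    are read off with the syzygies of [quotient_eq1] and [quotient_eqXn]. *)
Lemma line_section_AR_ge s : line_section u v (AR f) s ->
  r%:Z <= s \/ d%:Z - r%:Z <= s.
Proof.
move=> [k [k' [J [B [m0 [m1 [hm0 hm1 nz sE E]]]]]]].
have [h0 hh0 e0] := syzygy_cross fd fred rho_r hm0.
have [h1 hh1 e1] := syzygy_cross fd fred rho_r hm1.
have hE : 'X^B * th h1 = 'X^(J + k') * th h0.
  apply: (scale_row_inj th_grad); rewrite -!scalerA -!map_mxZ /=.
  by rewrite -e0 -e1 !cross_map -!crossZ E.
have [z0|n0] := eqVneq (th h0) 0.
  have z1 : th h1 = 0.
    move/eqP: hE; rewrite z0 mulr0 mulf_eq0 expf_eq0 polyX_eq0 andbF /=.
    by move/eqP.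
  have [p0 [q0 [s0 [g0 [hs0 es0 tg0 q0E]]]]] := quotient_eq1.
  have [p1 [q1 [s1 [g1 [hs1 es1 tg1 q1E]]]]] := quotient_eqXn.
  have [x0 hx0 E0] := quotient0_multiple hm0 hs0 e0 es0 z0.
  have [x1 hx1 E1] := quotient0_multiple hm1 hs1 e1 es1 z1.
  rewrite tg0 scale1r in E0; rewrite tg1 in E1.
  have xn0 : th x0 != 0 by apply: contraNneq nz => z; rewrite E0 z scale0r.
  have XE : 'X^B * th x1 = 'X^(q1 + (J + k')) * th x0.
    apply: (scale_row_inj th_rho).
    by rewrite -scalerA -E1 scalerA mulrC -scalerA E E0 !scalerA mulrA -exprD.
  have xn1 : th x1 != 0.
    apply: contraNneq xn0 => z; move/eqP: XE; rewrite z mulr0 eq_sym mulf_eq0.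
    by rewrite expf_eq0 polyX_eq0 andbF.
  left; have := size_theta_Sdeg hx1 xn1.
  have := congr1 (fun p : {poly K} => size p) XE; rewrite /= !size_XnM //.
  have : (0 < size (th x0))%N by rewrite size_poly_gt0.
  move: (size (th x0)) (size (th x1)) => *; lia.
right.
have n1 : th h1 != 0.
  apply: contraNneq n0 => z; move/eqP: hE; rewrite z mulr0 eq_sym mulf_eq0.
  by rewrite expf_eq0 polyX_eq0 andbF.
have := size_theta_Sdeg hh1 n1.
have := congr1 (fun p : {poly K} => size p) hE; rewrite /= !size_XnM //.
have : (0 < size (th h0))%N by rewrite size_poly_gt0.
move: (size (th h0)) (size (th h1)) => *; lia.
Qed.

Lemma line_section_AR_mdr : line_section u v (AR f) r%:Z.
Proof. by exists r, r, 0%N, r, rho, rho; split. Qed.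

(* The section of [O_L(-e)] lifts because [H^1(O_L(-1)) = 0]: the lifts on the
   two charts differ by a multiple of [rho] with coefficient [C] in
   [K[T, 1/T]], and [C] is a sum of an element of [K[T]] and one of [K[1/T]]. *)
Lemma line_section_AR_balanced : d.+1 = (2 * r)%N ->
  line_section u v (AR f) (d%:Z - r%:Z).
Proof.
move=> dr.
have [ta tb tc] := theta_frame frame.
have [p0 [q0 [s0 [g0 [hs0 es0 tg0 q0E]]]]] := quotient_eq1.
have [p1 [q1 [s1 [g1 [hs1 es1 tg1 q1E]]]]] := quotient_eqXn.
(* The difference of the two chart lifts, cleared of denominators; its image in the quotient
   vanishes on the line, so there it is a multiple of [rho]. *)
pose s := line_form c ^+ q1 *: s0 - line_form b ^+ q0 *: s1.
have hs : AR f (q1 + p0)%N%:Z s.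
  rewrite /s -scaleNr; apply: ARD.
    by rewrite PoszD; apply: ARZ => //; exact: homogXn.
  have -> : (q1 + p0)%N%:Z = q0%:Z + p1%:Z by lia.
  by apply: ARZ => //; apply: SdegN; exact: homogXn.
have es : cross rho s = (line_form c ^+ q1 * g0 - line_form b ^+ q0 * g1) *: grad f.
  by rewrite crossB !crossZ es0 es1 !scalerA scalerBl.
have [|x _] := quotient0_multiple hs hs0 es es0.
  by rewrite rmorphB !rmorphM !rmorphXn /= tb tc tg0 tg1 expr1n mulr1 mul1r subrr.
rewrite tg0 scale1r /s map_mxB !map_mxZ /= !rmorphXn /= tb tc expr1n scale1r => E.
(* On the line [T^q1 s0 - s1 = (B + A T^q1) rho]. The term [A] corrects [s0] and [B] corrects [s1];
   the latter has degree at most [q1 - 1], exactly the room available, as [p1 = q1 - 1 + r] by [dr].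
   The numbers [t] and [j] pad degrees so that [A] lifts to a form. *)
pose A := drop_poly q1 (th x); pose B := take_poly q1 (th x).
have CE : th x = B + A * 'X^q1 by rewrite poly_take_drop.
pose t := (size A + p0)%N; pose j := (size A + r)%N.
have [Ah hAh tAh] : exists2 h, Sdeg t%:Z h & th h = A.
  by apply: theta_lift frame _ _ _; rewrite /t; lia.
have [Bh hBh tBh] : exists2 h, Sdeg (q1%:Z - 1) h & th h = B.
  by apply: theta_lift frame _ _ _; rewrite subrK lez_nat size_take_poly.
pose m0 := line_form b ^+ j *: s0 - Ah *: rho.
pose m1 := s1 + Bh *: rho.
have tm0 : map_mx th m0 = map_mx th s0 - A *: map_mx th rho.
  by rewrite /m0 map_mxB !map_mxZ /= tAh rmorphXn /= tb expr1n scale1r.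
have tm1 : map_mx th m1 = map_mx th s1 + B *: map_mx th rho.
  by rewrite /m1 map_mxD map_mxZ /= tBh.
exists (j + p0)%N, p1, 0%N, (absz (d%:Z - r%:Z)%R), m0, m1; split.
- rewrite /m0 -scaleNr; apply: ARD.
    by rewrite PoszD; apply: ARZ => //; exact: homogXn.
  have -> : (j + p0)%N%:Z = t%:Z + r%:Z by rewrite /j /t; lia.
  by apply: ARZ => //; exact: SdegN.
- apply: ARD => //.
  have -> : p1%:Z = q1%:Z - 1 + r%:Z by lia.
  exact: ARZ.
(* The cross product of [rho] with [s0] is [grad f] on the line, and it would vanish if [s0] were a
   multiple of [rho] there. *)
- apply/eqP => z; move/eqP: th_grad; apply.
  have := congr1 (map_mx th) es0; rewrite map_mxZ /= tg0 scale1r => <-.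
  rewrite cross_map; move/eqP: z; rewrite tm0 subr_eq0 => /eqP ->.
  by rewrite crossZ; apply/rowP; apply: forall3; rewrite !mxE /=; ring.
- by lia.
rewrite tm0 tm1 add0n.
have -> : p1 = (absz (d%:Z - r%:Z)%R + q1)%N by lia.
rewrite exprD -scalerA; congr (_ *: _).
have -> : map_mx th s1 =
    'X^q1 *: map_mx th s0 - (B + A * 'X^q1) *: map_mx th rho.
  by rewrite -CE -E subKr.
by apply/rowP => i; rewrite !mxE; ring.
Qed.

End LineBounds.
End JumpingLines.

(** With [e = d - r], the minimum is [r] when [r <= e], and [rho] attains it. Otherwise the
    hypothesis [2 r <= d.+1] forces [e = r - 1], the balanced case. *)
Lemma splitting_type_avoid (K : numClosedFieldType) (d r : nat)
    (f : {mpoly K[3]}) rho (a : 'rV[K]_3) d1 d2 :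
    f \is d.+1.-homog -> reduced f -> is_mdr f r -> AR f r%:Z rho -> rho != 0 ->
    (2 * r <= d.+1)%N -> a != 0 ->
    (forall p, p != 0 -> dot a p = 0 -> ~ section_zero f rho p) ->
  splitting_type f a d1 d2 -> d1 = Num.min r%:Z (d%:Z - r%:Z).
Proof.
move=> fd fred fr rho_r rho0 le_r a0 avoid st.
have [b [c [u [v [w frame]]]]] := line_frame_exists a0.
have [sec ge] := splitting_type_line_section frame st.
have lower := line_section_AR_ge fd fred fr rho_r rho0 frame avoid sec.
have upper := ge _ (line_section_AR_mdr fd fr rho_r rho0 frame).
have [dr|dr] := eqVneq d.+1 (2 * r)%N.
  have := ge _ (line_section_AR_balanced fd fred fr rho_r rho0 frame avoid dr).
  by rewrite minEle; case: ifP; lia.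
by rewrite minEle; case: ifP; lia.
Qed.

(** * Counting conditions at points *)

Section LocalConditions.
Variable K : numClosedFieldType.
Local Notation S := {mpoly K[3]}.
Local Notation V k := (dhomog 3 K k).

Lemma linfun_exists (aT rT : vectType K) (g : aT -> rT) :
    (forall x a b, g (x *: a + b) = x *: g a + g b) ->
  exists phi : 'Hom(aT, rT), forall a, phi a = g a.
Proof.
move=> gl; pose gM := GRing.isLinear.Build _ _ _ _ g gl.
pose gL : {linear aT -> rT} := HB.pack g gM.
by exists (linfun gL) => a; rewrite lfunE.
Qed.

Lemma dim_forms k : \dim {: V k} = 'C(k + 2, k).
Proof. by rewrite dimvf. Qed.

(** [c] behaves as the quotient by a primary ideal supported at [p]. *)
Definition local_condition (p : 'rV[K]_3) n (c : S -> 'rV[K]_n) :=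
  [/\ forall x a b, c (x *: a + b) = x *: c a + c b,
      forall y m, dot y p = 0 -> c (line_form y ^+ n * m) = 0,
      exists y, forall m, c (line_form y * m) = c m
    & forall Q x, Q.@[fun i => p 0 i] != 0 ->
        exists k, exists2 m, m \is k.-homog & c (Q * m) = x].

(** Conditions at distinct points are independent in all large degrees, as in the Chinese remainder
    theorem: a form [Q] killed by the conditions at the other points but nonzero at [p i] leaves
    those at [p i] free. *)
Lemma local_conditions_codim (I : eqType) (p : I -> 'rV[K]_3) (n : I -> nat)
    (c : forall i, S -> 'rV[K]_(n i)) (s : seq I) :
    uniq s -> {in s, forall i, local_condition (p i) (@c i)} ->
    {in s &, forall i j, i != j -> exists2 y, dot y (p i) = 0 & dot y (p j) != 0} ->
  exists k0, forall k, (k0 <= k)%N -> exists2 W : {vspace V k},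
    (\dim W + \sum_(i <- s) n i)%N = 'C(k + 2, k) &
    forall m : V k, m \in W <-> {in s, forall i, c i m = 0}.
Proof.
elim: s => [|i s IH] /=.
  move=> _ _ _; exists 0%N => k _; exists fullv.
    by rewrite big_nil addn0 dim_forms.
  by move=> m; split=> // _; rewrite memvf.
move=> /andP[is_ us] hc sep.
have [j js|j j' js js'|k0 k0P] := IH us.
- by apply: hc; rewrite inE js orbT.
- by apply: sep; rewrite inE ?js ?js' orbT.
have [cl cv [y0 cy] cs] := hc i (mem_head _ _).
(* [Q] is the product over the other points of [n j]-th powers of linear forms vanishing at [p j]
   but not at [p i]. *)
have [Q [D [hQ Qi Qs]]] : exists Q D, [/\ Q \is D.-homog, Q.@[fun x => p i 0 x] != 0
    & {in s, forall j m, c j (Q * m) = 0}].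
  have : {subset s <= s} by [].
  elim: {-2}s => [|j t IHt] ts.
    exists 1, 0%N; split=> //; first exact: dhomog1.
    by rewrite meval1 oner_eq0.
  have js : j \in s by apply: ts; rewrite mem_head.
  have [|Q [D [hQ Qi Qt]]] := IHt.
    by move=> x xt; apply: ts; rewrite inE xt orbT.
  have [|||y yj yi] := sep j i.
  - by rewrite inE js orbT.
  - exact: mem_head.
  - by apply: contraNneq is_ => <-.
  exists (line_form y ^+ n j * Q), (n j + D)%N; split.
  - by rewrite dhomogM // homogXn.
  - by rewrite mevalM rmorphXn /= line_form_eval mulf_neq0 // expf_neq0.
  move=> x; rewrite inE => /orP[/eqP->|xt] m.
    have jis : j \in i :: s by rewrite inE js orbT.
    have [_ h _ _] := hc j jis.
    by rewrite -mulrA h.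
  by rewrite -mulrA mulrCA Qt.
have ex x : exists k, exists2 m, m \is k.-homog & c i (Q * m) = x.
  exact: cs.
have [kk kkP] := choice (fun a : 'I_(n i) => ex (delta_mx 0 a)).
pose k1 := (\max_(a < n i) kk a)%N.
exists (maxn k0 (D + k1)) => k; rewrite geq_max => /andP[k0k k1k].
have [W' dW' W'P] := k0P k k0k.
have [phi phiE] := @linfun_exists (V k) 'rV[K]_(n i) (fun m => c i m)
  (fun x a b => cl x a b).
have full : (phi @: W' = fullv)%VS.
  apply/eqP; rewrite eqEsubv subvf; apply/subvP => x _.
  rewrite (row_sum_delta x); apply: memv_suml => a _; apply: memvZ.
  have [m hm cm] := kkP a.
  have ka : (kk a <= k1)%N by exact: leq_bigmax.
  (* The power of [line_form y0] raises the degree to [k] without changing the value of [c i]. *)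
  have hw : line_form y0 ^+ (k - D - kk a) * (Q * m) \is k.-homog.
    have kE : (k - D - kk a + (D + kk a))%N = k.
      by move: ka k1k; move: (kk a) k1 => *; lia.
    by have := dhomogM (homogXn y0 (k - D - kk a)) (dhomogM hQ hm); rewrite kE.
  have cw : c i (line_form y0 ^+ (k - D - kk a) * (Q * m)) = delta_mx 0 a.
    elim: (_ - _)%N => [|q IHq]; first by rewrite expr0 mul1r.
    by rewrite exprS -mulrA cy.
  rewrite -cw -(phiE (DHomog hw)); apply: memv_img.
  by apply/W'P => j js /=; rewrite mulrCA Qs.
exists (W' :&: lker phi)%VS.
  rewrite big_cons -dW' -(limg_ker_dim phi W') full -addnA; congr addn.
  by rewrite dimvf /dim /= mul1n.
move=> m; rewrite memv_cap memv_ker phiE; split=> [/andP[/W'P h /eqP h'] j|h].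
  by rewrite inE => /orP[/eqP->|/h].
apply/andP; split; last by rewrite h ?mem_head.
by apply/W'P => j js; apply: h; rewrite inE js orbT.
Qed.
End LocalConditions.

(** * Dimension count for syzygies *)

Section Count.
Variables (K : numClosedFieldType) (d r : nat) (f : {mpoly K[3]}).
Local Notation S := {mpoly K[3]}.
Local Notation V k := (dhomog 3 K k).
Hypotheses (fd : f \is d.+1.-homog) (fred : reduced f).
Variable rho : 'rV[S]_3.
Hypotheses (fr : is_mdr f r) (rho_r : AR f r%:Z rho) (rho0 : rho != 0).
Hypothesis le_rd : (r <= d)%N.

Definition vec_of m (x : {ffun 'I_3 -> V m}) : 'rV[S]_3 := \row_i (x i : S).

Lemma vec_of_linear m z (x y : {ffun 'I_3 -> V m}) :
  vec_of (z *: x + y) = z%:MP *: vec_of x + vec_of y.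
Proof. by apply/rowP => i; rewrite !mxE !ffunE mul_mpolyC. Qed.

Lemma vec_of_inj m : injective (@vec_of m).
Proof.
move=> x y /rowP e; apply/ffunP => i; apply: val_inj.
by have := e i; rewrite !mxE.
Qed.

(** [dim J_k + dim AR_m = 3 dim S_m] for [k = m + d], and
    [dim AR_m <= dim S_(m-r) + dim U] where [U] contains all the forms [h(x)]. *)
Lemma jacobian_count (m : nat) (W : {vspace V (m + d)})
    (U : {vspace V (m + r - d)}) :
    (d <= m)%N ->
    (forall x : 'rV[S]_3, (forall i, x 0 i \is m.-homog) ->
       forall h : V (m + d), val h = dot x (grad f) -> h \in W) ->
    (forall x : 'rV[S]_3, AR f m%:Z x ->
       forall h : V (m + r - d), cross rho x = (val h) *: grad f -> h \in U) ->
  (3 * 'C(m + 2, m) <= \dim W + 'C(m - r + 2, m - r) + \dim U)%N.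
Proof.
move=> dm hW hU.
have dotD (x y z : 'rV[S]_3) (t : S) : dot (t *: x + y) z = t * dot x z + dot y z.
  by rewrite /dot !sum3 !mxE; ring.
have vh (x : {ffun 'I_3 -> V m}) i : vec_of x 0 i \is m.-homog.
  by rewrite mxE; exact: dhomog_is_dhomog.
have hG (x : {ffun 'I_3 -> V m}) : dot (vec_of x) (grad f) \is (m + d).-homog.
  apply: rpred_sum => i _; rewrite [grad f _ _]mxE.
  exact: (dhomogM (vh x i) (mderiv_homog i fd)).
(* Four linear maps are used: [G] is the product with [grad f], with kernel [AR] in degree [m]; [X]
   is the cross product with [rho]; [T] and [Rm] multiply [grad f] and [rho] by a form. The image of
   ker [G] under [X] lies in [T(U)], and ker [G] meets ker [X] inside the image of [Rm]. *)
have [G GE] : exists G : 'Hom({ffun 'I_3 -> V m}, V (m + d)),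
    forall x, G x = DHomog (hG x).
  apply: linfun_exists => z x y; apply: val_inj => /=.
  by rewrite vec_of_linear dotD mul_mpolyC.
have hX (x : {ffun 'I_3 -> V m}) i : cross rho (vec_of x) 0 i \is (m + r).-homog.
  have [hr _] := rho_r.
  have E (a b c e : 'I_3) :
      rho 0 a * vec_of x 0 b - rho 0 c * vec_of x 0 e \is (m + r).-homog.
    by rewrite addnC; apply: rpredB; apply: dhomogM => //; exact: hr.
  by move: i; apply: forall3; rewrite mxE /=; exact: E.
have [X XE] : exists X : 'Hom({ffun 'I_3 -> V m}, {ffun 'I_3 -> V (m + r)}),
    forall x, X x = [ffun i => DHomog (hX x i)].
  have XD z x y i : cross rho (vec_of (z *: x + y)) 0 i =
      z *: cross rho (vec_of x) 0 i + cross rho (vec_of y) 0 i.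
    rewrite vec_of_linear (crossD rho (z%:MP *: vec_of x)).
    rewrite (crossZ z%:MP rho) mxE [X in X + _]mxE mul_mpolyC.
    reflexivity.
  apply: linfun_exists => z x y; apply/ffunP => i; rewrite !ffunE.
  apply: val_inj; exact: XD.
have hT (h : V (m + r - d)) i : (val h * grad f 0 i) \is (m + r).-homog.
  have e : (m + r - d + d)%N = (m + r)%N by lia.
  by have := dhomogM (dhomog_is_dhomog h) (mderiv_homog i fd); rewrite e mxE.
have [T TE] : exists T : 'Hom(V (m + r - d), {ffun 'I_3 -> V (m + r)}),
    forall h, T h = [ffun i => DHomog (hT h i)].
  apply: linfun_exists => z x y; apply/ffunP => i; rewrite !ffunE.
  by apply: val_inj; rewrite /= mulrDl scalerAl.
have hR (h : V (m - r)) i : (val h * rho 0 i) \is m.-homog.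
  have [hr _] := rho_r.
  have e : (m - r + r)%N = m by lia.
  have := dhomogM (dhomog_is_dhomog h) (hr i); rewrite e.
  exact.
have [Rm RE] : exists Rm : 'Hom(V (m - r), {ffun 'I_3 -> V m}),
    forall h, Rm h = [ffun i => DHomog (hR h i)].
  apply: linfun_exists => z x y; apply/ffunP => i; rewrite !ffunE.
  by apply: val_inj; rewrite /= mulrDl scalerAl.
have kerAR x : x \in lker G -> AR f m%:Z (vec_of x).
  rewrite memv_ker GE => /eqP/(congr1 val) /= e.
  by apply: dot_AR e => i; exact: vh.
have imgW : (limg G <= W)%VS.
  apply/subvP => _ /memv_imgP[x _ ->]; rewrite GE.
  by apply: (hW (vec_of x)) => // i; exact: vh.
have imgU : (X @: lker G <= T @: U)%VS.
  apply/subvP => _ /memv_imgP[x /kerAR xAR ->].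
  have [h hh e] := syzygy_cross fd fred rho_r xAR.
  have hh' : h \is (m + r - d)%N.-homog.
    by move: hh; have -> : r%:Z + m%:Z - d%:Z = (m + r - d)%N%:Z by lia.
  have -> : X x = T (DHomog hh').
    rewrite XE TE; apply/ffunP => i; rewrite !ffunE; apply: val_inj.
    suff : cross rho (vec_of x) 0 i = h * grad f 0 i by [].
    by rewrite e !mxE.
  by apply/memv_img/(hU _ xAR).
have kerR : (lker G :&: lker X <= limg Rm)%VS.
  apply/subvP => x; rewrite memv_cap => /andP[/kerAR xAR].
  rewrite memv_ker XE => /eqP/ffunP x0.
  have [hx _] := xAR.
  have [|c hc cE] := mdr_multiple fd fr rho_r rho0 hx.
    by apply/rowP => i; rewrite [RHS]mxE; have := congr1 val (x0 i); rewrite !ffunE.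
  have hc' : c \is (m - r)%N.-homog.
    by move: hc; have -> : m%:Z - r%:Z = (m - r)%N%:Z by lia.
  have -> : x = Rm (DHomog hc').
    rewrite RE; apply: vec_of_inj; rewrite cE; apply/rowP => i.
    by rewrite !mxE ffunE.
  by apply: memv_img; exact: memvf.
have dimT : (\dim (T @: U) <= \dim U)%N.
  by rewrite -(limg_ker_dim T U) leq_addl.
have dimR : (\dim (limg Rm) <= 'C(m - r + 2, m - r))%N.
  by rewrite -(@dim_forms K) -(limg_ker_dim Rm fullv) leq_addl.
have dimV : \dim {: {ffun 'I_3 -> V m}} = (3 * 'C(m + 2, m))%N.
  by rewrite dimvf /dim /= card_ord.
rewrite -dimV -(limg_ker_dim G fullv) capfv -(limg_ker_dim X (lker G)).
rewrite addnC -addnA leq_add ?leq_add ?dimvS //.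
- exact: leq_trans (dimvS kerR) dimR.
- exact: leq_trans (dimvS imgU) dimT.
Qed.
End Count.

(** * Tjurina numbers *)

Lemma separating_form (K : numClosedFieldType) (p q : 'rV[K]_3) :
  cross p q != 0 -> exists2 y, dot y p = 0 & dot y q != 0.
Proof.
move=> pq; have [i pqi] : exists i, cross p q 0 i != 0.
  apply/existsP; rewrite -negb_forall; apply: contra pq => /forallP h.
  by apply/eqP/rowP => i; rewrite (eqP (h i)) mxE.
(* The lines [p_a x_b - p_b x_a = 0] pass through [p]; their equations take at [q] the coordinates
   of the cross product, up to sign. *)
pose y (a b : 'I_3) : 'rV[K]_3 := \row_x (p 0 a * (x == b)%:R - p 0 b * (x == a)%:R).
have yE (a b : 'I_3) z : dot (y a b) z = p 0 a * z 0 b - p 0 b * z 0 a.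
  rewrite /dot; under eq_bigr do rewrite mxE mulrBl.
  rewrite sumrB (bigD1 b) //= eqxx mulr1 big1 ?addr0; last first.
    by move=> j /negbTE ->; rewrite mulr0 mul0r.
  rewrite (bigD1 a) //= eqxx mulr1 big1 ?addr0 //.
  by move=> j /negbTE ->; rewrite mulr0 mul0r.
move: i pqi; apply: forall3; rewrite mxE /= => h.
- by exists (y o1 o2); rewrite yE // mulrC subrr.
- by exists (y o2 o0); rewrite yE // mulrC subrr.
- by exists (y o0 o1); rewrite yE // mulrC subrr.
Qed.

Lemma eval_local_condition (K : numClosedFieldType) (p : 'rV[K]_3) : p != 0 ->
  local_condition p (fun m => const_mx (m.@[fun i => p 0 i]) : 'rV[K]_1).
Proof.
move=> p0; have [i pi] : exists i, p 0 i != 0.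
  apply/existsP; rewrite -negb_forall; apply: contra p0 => /forallP h.
  by apply/eqP/rowP => i; rewrite (eqP (h i)) mxE.
split.
- by move=> x a b; apply/rowP => j; rewrite !mxE mevalD mevalZ.
- move=> y m y0; apply/rowP => j.
  by rewrite !mxE expr1 mevalM line_form_eval y0 mul0r.
- exists (\row_j ((j == i)%:R / p 0 i)) => m; apply/rowP => j.
  rewrite !mxE mevalM line_form_eval (_ : dot _ _ = 1) ?mul1r //.
  rewrite /dot (bigD1 i) //= mxE eqxx mul1r mulVf // big1 ?addr0 // => x /negbTE xi.
  by rewrite mxE xi !mul0r.
move=> Q x Q0; exists 0%N, (x 0 0 / Q.@[fun i => p 0 i])%:MP.
  by rewrite -[_%:MP]mulr1 mul_mpolyC; apply: rpredZ; exact: dhomog1.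
by apply/rowP => j; rewrite mxE mevalM mevalC mulrC mulfVK // ord1.
Qed.

Section Tjurina.
Variable K : numClosedFieldType.
Local Notation A := {mpoly K[2]}.
Local Notation F := {fraction A}.
Local Notation O := (@local_ring K).
Local Notation at0 a := (a.@[fun _ : 'I_2 => 0 : K]).

Lemma local_ring_poly (a : A) : O a%:F.
Proof. by exists a, 1; rewrite meval1 oner_neq0 rmorph1 divr1. Qed.

Lemma local_ringM x y : O x -> O y -> O (x * y).
Proof.
move=> [a [s [s0 ->]]] [b [t [t0 ->]]]; exists (a * b), (s * t).
by rewrite mevalM mulf_neq0 // !rmorphM mulf_div.
Qed.

Lemma local_ringD x y : O x -> O y -> O (x + y).
Proof.
have nz (s : A) : at0 s != 0 -> s%:F != 0.
  by rewrite tofrac_eq0; apply: contraNneq => ->; rewrite meval0.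
move=> [a [s [s0 ->]]] [b [t [t0 ->]]]; exists (a * t + b * s), (s * t).
rewrite mevalM mulf_neq0 //; split=> //.
by rewrite rmorphD !rmorphM addf_div ?nz.
Qed.

Lemma local_ringV (s : A) : at0 s != 0 -> O (s%:F)^-1.
Proof. by move=> s0; exists 1, s; rewrite rmorph1 div1r. Qed.

Variable g : A.
Local Notation I := (tjurina_ideal g).

Lemma tjurina_idealM x y : O x -> I y -> I (x * y).
Proof.
move=> Ox [b [c [Ob Oc ->]]]; exists (x * b), (fun i => x * c i); split.
- exact: local_ringM.
- by move=> i; exact: local_ringM.
by rewrite mulrDr mulrA mulr_sumr; congr (_ + _); apply: eq_bigr => i _; rewrite mulrA.
Qed.

Lemma tjurina_idealD x y : I x -> I y -> I (x + y).
Proof.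
move=> [b [c [Ob Oc ->]]] [b' [c' [Ob' Oc' ->]]].
exists (b + b'), (fun i => c i + c' i); split.
- exact: local_ringD.
- by move=> i; exact: local_ringD.
rewrite mulrDl addrACA -big_split; congr (_ + _).
by apply: eq_bigr => i _; rewrite mulrDl.
Qed.

Lemma local_ring0 : O 0.
Proof. by rewrite -(rmorph0 (@tofrac A)); exact: local_ring_poly. Qed.

Lemma local_ring1 : O 1.
Proof. by rewrite -(rmorph1 (@tofrac A)); exact: local_ring_poly. Qed.

Lemma tjurina_ideal0 : I 0.
Proof.
exists 0, (fun=> 0); split=> *; try exact: local_ring0.
by rewrite mul0r big1 ?addr0 // => i _; rewrite mul0r.
Qed.

Lemma tjurina_ideal_eq : I g%:F.
Proof.
exists 1, (fun=> 0); split=> *; [exact: local_ring1 | exact: local_ring0 |].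
by rewrite mul1r big1 ?addr0 // => i _; rewrite mul0r.
Qed.

Lemma tjurina_ideal_deriv k : I (g^`M(k))%:F.
Proof.
exists 0, (fun i => (i == k)%:R); split.
- exact: local_ring0.
- by move=> i; case: eqP => _; [exact: local_ring1 | exact: local_ring0].
rewrite mul0r add0r (bigD1 k) //= eqxx mul1r big1 ?addr0 // => i /negbTE ->.
by rewrite mul0r.
Qed.

Lemma tjurina_idealN x : I x -> I (- x).
Proof.
move=> Ix; rewrite -mulN1r; apply: tjurina_idealM => //.
by rewrite -(rmorphN1 (@tofrac A)); exact: local_ring_poly.
Qed.

End Tjurina.

(** * Finite-dimensional quotients of the local ring *)

Section Coordinates.
Variables (K : numClosedFieldType) (g : {mpoly K[2]}) (n : nat).
Local Notation A := {mpoly K[2]}.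
Local Notation F := {fraction A}.
Local Notation O := (@local_ring K).
Local Notation I := (tjurina_ideal g).
Local Notation at0 a := (a.@[fun _ : 'I_2 => 0 : K]).
Variable w : 'I_n -> F.
Hypothesis wO : forall i, O (w i).
Hypothesis wB : forall x, O x -> exists! c : {ffun 'I_n -> K},
  I (x - \sum_(i < n) ((c i)%:MP_[2])%:F * w i).

Definition combination (c : {ffun 'I_n -> K}) : F :=
  \sum_(i < n) ((c i)%:MP_[2])%:F * w i.

Lemma combinationP z (c c' : {ffun 'I_n -> K}) :
  combination [ffun i => z * c i + c' i] =
  (z%:MP)%:F * combination c + combination c'.
Proof.
rewrite /combination mulr_sumr -big_split; apply: eq_bigr => i _ /=.
by rewrite ffunE mpolyCD mpolyCM rmorphD rmorphM mulrDl mulrA.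
Qed.

Lemma combination_local c : O (combination c).
Proof.
apply: (big_ind O) => [|x y|i _]; first exact: local_ring0.
  exact: local_ringD.
by apply: local_ringM => //; exact: local_ring_poly.
Qed.

Lemma coordinates : exists c : A -> 'rV[K]_n,
  [/\ forall z a b, c (z *: a + b) = z *: c a + c b,
      forall a, c a = 0 <-> I a%:F
    & forall a (x : {ffun 'I_n -> K}), I (a%:F - combination x) ->
        c a = \row_i x i].
Proof.
have [c0 c0P] := choice (fun a : A => wB (local_ring_poly a)).
have uniq a x : I (a%:F - combination x) -> c0 a = x by have [_] := c0P a; apply.
have mem a : I (a%:F - combination (c0 a)) by have [] := c0P a.
exists (fun a => \row_i c0 a i); split.
- move=> z a b; have -> : c0 (z *: a + b) = [ffun i => z * c0 a i + c0 b i].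
    apply: uniq; rewrite combinationP -mul_mpolyC rmorphD rmorphM opprD addrACA.
    apply: tjurina_idealD (mem b); rewrite -mulrBr.
    apply: tjurina_idealM (mem a); exact: local_ring_poly.
  by apply/rowP => i; rewrite !mxE ffunE.
- have z0 : combination [ffun=> 0] = 0.
    by rewrite /combination big1 // => i _; rewrite ffunE mpolyC0 rmorph0 mul0r.
  move=> a; split=> [/rowP e|h].
    have := mem a; rewrite (_ : c0 a = [ffun=> 0]) ?z0 ?subr0 //.
    by apply/ffunP => i; have := e i; rewrite !mxE ffunE.
  apply/rowP => i; rewrite (uniq a [ffun=> 0]) ?z0 ?subr0 //.
  by rewrite !mxE ffunE.
by move=> a x h; rewrite (uniq _ _ h).
Qed.

(* The [n + 1] powers [1, t, ..., t ^ n] are linearly dependent modulo [I], and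
   a nonzero polynomial in [t] is a unit times a power of [t]. *)
Lemma maximal_ideal_nilpotent (t : A) : at0 t = 0 -> I (t ^+ n)%:F.
Proof.
move=> t0; have [c [cl c0 _]] := coordinates.
pose M : 'M[K]_(n.+1, n) := \matrix_(i, j) c (t ^+ i) 0 j.
have [k k0 kM] : exists2 k : 'rV[K]_n.+1, k != 0 & k *m M = 0.
  have : kermx M != 0.
    by rewrite kermx_eq0 -row_leq_rank -ltnNge (leq_ltn_trans (rank_leq_col M)).
  move=> /rowV0Pn[k kk k0]; exists k => //; exact/sub_kermxP.
have c00 : c 0 = 0 by apply/c0; rewrite rmorph0; exact: tjurina_ideal0.
have csum : c (\sum_(i < n.+1) k 0 i *: t ^+ i) = 0.
  rewrite -[RHS]kM; have -> : k *m M = \sum_(i < n.+1) k 0 i *: c (t ^+ i).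
    apply/rowP => j; rewrite mxE summxE; apply: eq_bigr => i _.
    by rewrite !mxE.
  elim/big_rec2: _ => [//|i x y _ e]; by rewrite cl e.
have [i ki kmin] : exists2 i : 'I_n.+1,
    k 0 i != 0 & forall j : 'I_n.+1, (j < i)%N -> k 0 j = 0.
  have [i0 ki0] : exists i, k 0 i != 0.
    apply/existsP; rewrite -negb_forall; apply: contra k0 => /forallP h.
    by apply/eqP/rowP => i; rewrite (eqP (h i)) mxE.
  case: (@arg_minnP _ i0 (fun i => k 0 i != 0) val ki0) => i ki imin.
  exists i => // j ji; apply/eqP; apply: contraTT ji => /imin.
  by rewrite leqNgt.
pose s := \sum_(j < n.+1) k 0 j *: t ^+ (j - i).
have sE : \sum_(j < n.+1) k 0 j *: t ^+ j = t ^+ i * s.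
  rewrite mulr_sumr; apply: eq_bigr => j _; rewrite -scalerAr -exprD.
  case: (ltnP j i) => [/kmin ->|ij]; first by rewrite !scale0r.
  by rewrite subnKC.
have s0 : at0 s != 0.
  rewrite /s rmorph_sum (bigD1 i) //= subnn expr0 mevalZ meval1 mulr1.
  rewrite big1 ?addr0 // => j ji; rewrite mevalZ rmorphXn /= t0.
  case: (ltnP j i) => [/kmin ->|ij]; first by rewrite mul0r.
  have ltij : (i < j)%N by rewrite ltn_neqAle eq_sym ij andbT; exact: ji.
  by rewrite expr0n subn_eq0 leqNgt ltij mulr0.
have sF : s%:F != 0.
  by rewrite tofrac_eq0; apply: contraNneq s0 => ->; rewrite meval0.
have /(tjurina_idealM (local_ringV s0)) Ii : I (t ^+ i * s)%:F.
  by apply/c0; rewrite -sE.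
have Iti : I (t ^+ i)%:F.
  by move: Ii; rewrite rmorphM mulrCA mulVf // mulr1.
have -> : t ^+ n = t ^+ (n - i) * t ^+ i by rewrite -exprD subnK // -ltnS.
rewrite rmorphM; apply: tjurina_idealM => //; exact: local_ring_poly.
Qed.

(** Modulo [I], the inverse of [s] is a truncated geometric series in [z = 1 - s / s(0)], whose
    [n]-th power lies in [I]. *)
Lemma local_ring_polynomial x : O x -> exists b : A, I (x - b%:F).
Proof.
move=> [a [s [s0 ->]]].
have sF : s%:F != 0.
  by rewrite tofrac_eq0; apply: contraNneq s0 => ->; rewrite meval0.
pose z := 1 - (at0 s)^-1 *: s.
have z0 : at0 z = 0 by rewrite mevalB mevalZ meval1 mulVf // subrr.
pose b := (at0 s)^-1 *: (a * \sum_(i < n) z ^+ i).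
have e : a - b * s = a * z ^+ n.
  have -> : b * s = a * ((1 - z) * \sum_(i < n) z ^+ i).
    have -> : 1 - z = (at0 s)^-1 *: s by rewrite /z subKr.
    by rewrite /b -!scalerAl -scalerAr; congr (_ *: _); ring.
  have -> : (1 - z) * \sum_(i < n) z ^+ i = 1 - z ^+ n.
    by rewrite -opprB mulNr -subrX1 opprB.
  by rewrite mulrBr mulr1 subKr.
exists b; have -> : a%:F / s%:F - b%:F = (a%:F * (s%:F)^-1) * (z ^+ n)%:F.
  rewrite -{1}[b%:F](mulfK sF) -mulrBl -rmorphM -rmorphB e rmorphM.
  by rewrite mulrAC.
apply: tjurina_idealM; last exact: maximal_ideal_nilpotent.
by apply: local_ringM; [exact: local_ring_poly | exact: local_ringV].
Qed.

End Coordinates.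

Section Dehomogenization.
Variables (K : numClosedFieldType) (p : 'rV[K]_3).
Hypothesis p0 : p != 0.
Local Notation S := {mpoly K[3]}.
Local Notation A := {mpoly K[2]}.
Local Notation at0 a := (a.@[fun _ : 'I_2 => 0 : K]).
Local Notation j := (odflt ord0 [pick j | p 0 j != 0]).

Let pj : p 0 j != 0.
Proof.
case: pickP => [//|h] /=; case/eqP: p0; apply/rowP => i.
by rewrite mxE; have /negbFE/eqP := h i.
Qed.

(** The substitution of [local_equation]: [dehomogenize f] and [local_equation f p] are
    convertible. *)
Definition affine_chart : 3.-tuple A :=
  [tuple (p 0 i)%:MP + (if unlift j i is Some k then 'X_k else 0) | i < 3].

Definition dehomogenize (m : S) : A := m \mPo affine_chart.

HB.instance Definition _ := GRing.RMorphism.copy dehomogenize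
  (comp_mpoly affine_chart).

Lemma dehomogenizeZ x m : dehomogenize (x *: m) = x *: dehomogenize m.
Proof. by rewrite /dehomogenize comp_mpolyZ. Qed.

Lemma dehomogenizeX i : dehomogenize 'X_i =
  (p 0 i)%:MP + (if unlift j i is Some k then 'X_k else 0).
Proof. by rewrite /dehomogenize comp_mpolyXU -tnth_nth tnth_mktuple. Qed.

Lemma dehomogenizeXj : dehomogenize 'X_j = (p 0 j)%:MP.
Proof. by rewrite dehomogenizeX unlift_none addr0. Qed.

Lemma dehomogenize_at0 m : at0 (dehomogenize m) = m.@[fun i => p 0 i].
Proof.
rewrite /dehomogenize comp_mpoly_meval; apply: meval_eq => i.
rewrite tnth_mktuple mevalD mevalC; case: (unlift _ _) => [k|].
  by rewrite mevalXU addr0.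
by rewrite meval0 addr0.
Qed.

Lemma dehomogenize_deriv m k :
  (dehomogenize m)^`M(k) = dehomogenize m^`M(lift j k).
Proof.
elim/mpolyind: m => [|x e m _ _ IH]; first by rewrite !raddf0.
rewrite rmorphD /= !mderivD rmorphD /= IH; congr (_ + _).
rewrite dehomogenizeZ !mderivZ dehomogenizeZ; congr (_ *: _).
rewrite mpolyXE_id; elim/big_ind: _ => [|a b ha hb|i _].
- by rewrite rmorph1 -!mpolyC1 !mderivC raddf0.
- by rewrite rmorphM /= !mderivM rmorphD !rmorphM /= ha hb.
elim: (e i) => [|q IHq]; first by rewrite !expr0 rmorph1 -!mpolyC1 !mderivC raddf0.
rewrite exprS rmorphM /= !mderivM rmorphD !rmorphM /= IHq; congr (_ * _ + _).
rewrite dehomogenizeX mderivD mderivC add0r mderivX mnm1E.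
case: unliftP => [k' ->|->].
  rewrite mderivX mnm1E (inj_eq (@lift_inj _ j)); case: eqP => [->|_].
    have sub0 N (u : 'I_N) : (U_(u) - U_(u))%MM = 0%MM.
      by apply/mnmP => i'; rewrite mnmBE subnn mnm0E.
    by rewrite !scale1r !sub0 !mpolyX0 rmorph1.
  by rewrite !scale0r raddf0.
by rewrite mderiv0 (negbTE (neq_lift _ _)) scale0r raddf0.
Qed.

Lemma dehomogenize_lift (b : A) : exists k, exists2 m : S,
  m \is k.-homog & dehomogenize m = b.
Proof.
(* The form [y] becomes 1 and adjusts degrees; ['X_i - p_i y] becomes the affine coordinate centered
   at [p]. *)
pose y : S := (p 0 j)^-1 *: 'X_j.
have hy k : y ^+ k \is k.-homog.
  have : y \is 1.-homog by apply: rpredZ; rewrite dhomogX /= mdeg1.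
  by move=> /(dhomogMn k); rewrite mul1n.
have dy k : dehomogenize (y ^+ k) = 1.
  rewrite rmorphXn /= dehomogenizeZ dehomogenizeXj -mul_mpolyC -mpolyCM.
  by rewrite mulVf // mpolyC1 expr1n.
elim/mpolyind: b => [|x e b _ _ [k [m hm <-]]].
  by exists 0%N, 0; [exact: dhomog0 | rewrite rmorph0].
have [k' [m' hm' m'E]] : exists k, exists2 m : S,
    m \is k.-homog & dehomogenize m = 'X_[e].
  rewrite mpolyXE_id; elim/big_ind: _ => [|_ _ [k1 [m1 h1 <-]] [k2 [m2 h2 <-]]|i _].
  - by exists 0%N, 1; [exact: dhomog1 | rewrite rmorph1].
  - by exists (k1 + k2)%N, (m1 * m2); [exact: dhomogM | rewrite rmorphM].
  exists (1 * e i)%N, (('X_(lift j i) - p 0 (lift j i) *: y) ^+ e i).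
    apply: dhomogMn; apply: rpredB; first by rewrite dhomogX /= mdeg1.
    by apply: rpredZ; exact: (hy 1%N).
  rewrite rmorphXn rmorphB /= dehomogenizeZ (dy 1%N) dehomogenizeX liftK.
  by rewrite -mul_mpolyC mulr1 [X in X - _]addrC addrK.
exists (k' + k)%N, (x *: (y ^+ k * m') + y ^+ k' * m).
  by apply: rpredD; [apply: rpredZ; rewrite addnC|]; apply: dhomogM.
by rewrite rmorphD /= dehomogenizeZ !rmorphM /= !dy !mul1r m'E.
Qed.

(** The chart sees the partial derivatives other than the [j]-th; Euler's formula, with [x_j = p_j]
    invertible, expresses that one through [f] and the others. *)
Lemma jacobian_in_tjurina d (f : S) i : f \is d.-homog ->
  tjurina_ideal (dehomogenize f) (dehomogenize f^`M(i))%:F.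
Proof.
move=> fd; set I := tjurina_ideal _.
have lifted k : I (dehomogenize f^`M(lift j k))%:F.
  by rewrite -dehomogenize_deriv; exact: tjurina_ideal_deriv.
case: (unliftP j i) => [k ->|->]; first exact: lifted.
have : I ((p 0 j)%:MP * dehomogenize f^`M(j))%:F.
  have := congr1 dehomogenize (euler_formula fd).
  rewrite rmorph_sum (bigD1_ord j) //= dehomogenizeZ rmorphM /= dehomogenizeXj.
  move=> /(canRL (addrK _)) ->; rewrite rmorphB.
  apply: tjurina_idealD.
    rewrite -mul_mpolyC rmorphM; apply: tjurina_idealM; last exact: tjurina_ideal_eq.
    exact: local_ring_poly.
  apply: tjurina_idealN; rewrite rmorph_sum.
  apply: (big_ind I) => [|x y|k _]; [exact: tjurina_ideal0 | exact: tjurina_idealD |].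
  rewrite rmorphM rmorphM; apply: tjurina_idealM; last exact: lifted.
  exact: local_ring_poly.
move=> /(tjurina_idealM (local_ring_poly ((p 0 j)^-1)%:MP)).
by rewrite -rmorphM mulrA -mpolyCM mulVf // mul1r.
Qed.

(** The condition sends a form to its class in the Tjurina algebra at [p]. Forms vanishing at [p]
    have their [n]-th power zero there, and forms not vanishing at [p] are invertible, with every
    class represented by a polynomial and hence by a form. *)
Lemma tjurina_local_condition d (f : S) n : f \is d.-homog ->
  is_codim (@local_ring K) (tjurina_ideal (local_equation f p)) n ->
  exists2 c : S -> 'rV[K]_n, local_condition p c
    & forall i m, c (m * f^`M(i)) = 0.
Proof.
move=> fd [w [wO wB]].
have [c [cl c0 cc]] := coordinates wB.
have nilp := maximal_ideal_nilpotent wB.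
have poly := local_ring_polynomial wB.
set I := tjurina_ideal _ in nilp poly c0 cc.
exists (fun m => c (dehomogenize m)); last first.
  move=> i m; apply/c0; rewrite rmorphM /= rmorphM.
  apply: tjurina_idealM; first exact: local_ring_poly.
  exact: jacobian_in_tjurina fd.
split.
- by move=> x a b; rewrite rmorphD /= dehomogenizeZ cl.
- move=> y m yp; apply/c0; rewrite rmorphM rmorphXn /= mulrC rmorphM.
  apply: tjurina_idealM; first exact: local_ring_poly.
  by apply: nilp; rewrite dehomogenize_at0 line_form_eval.
- exists (\row_i ((i == j)%:R / p 0 j)) => m; congr c.
  rewrite rmorphM /= (_ : dehomogenize (line_form _) = 1) ?mul1r //.
  rewrite /line_form (bigD1 j) //= mxE eqxx big1 ?addr0.
    rewrite dehomogenizeZ dehomogenizeXj -mul_mpolyC -mpolyCM.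
    by rewrite mul1r mulVf // mpolyC1.
  by move=> i /negbTE ij; rewrite mxE ij mul0r scale0r.
move=> Q x Q0.
have Qu : at0 (dehomogenize Q) != 0 by rewrite dehomogenize_at0.
have Q1 : (dehomogenize Q)%:F != 0.
  by rewrite tofrac_eq0; apply: contraNneq Qu => ->; rewrite meval0.
pose x' : {ffun 'I_n -> K} := [ffun i => x 0 i].
have [b bP] := poly _ (local_ringM (local_ringV Qu) (combination_local wO x')).
have [k [m hm mE]] := dehomogenize_lift b.
exists k, m => //.
rewrite (cc _ x').
  by apply/rowP => i; rewrite mxE ffunE.
rewrite rmorphM /= mE rmorphM -opprB; apply: tjurina_idealN.
have -> : combination w x' - (dehomogenize Q)%:F * b%:F =
  (dehomogenize Q)%:F * ((dehomogenize Q)%:F^-1 * combination w x' - b%:F).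
  by rewrite mulrBr mulVKf.
by apply: tjurina_idealM bP; exact: local_ring_poly.
Qed.

End Dehomogenization.

(** * The bound *)

Lemma cross_eq0_line (K : numClosedFieldType) (u v : 'rV[K]_3) :
  u != 0 -> cross u v = 0 -> exists x, v = x *: u.
Proof.
move=> u0 /cross_eq0 par; have [i ui] : exists i, u 0 i != 0.
  apply/existsP; rewrite -negb_forall; apply: contra u0 => /forallP h.
  by apply/eqP/rowP => i; rewrite (eqP (h i)) mxE.
exists (v 0 i / u 0 i); apply/rowP => j; rewrite mxE.
by apply: (mulIf ui); rewrite mulrAC mulfVK // par.
Qed.

Lemma cross_vpick_neq0 (K : numClosedFieldType) (p q : {vspace 'rV[K]_3}) :
  \dim p = 1%N -> \dim q = 1%N -> p != q -> cross (vpick p) (vpick q) != 0.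
Proof.
move=> dp dq; apply: contraNneq.
have p0 : vpick p != 0 by rewrite vpick0 -dimv_eq0 dp.
have q0 : vpick q != 0 by rewrite vpick0 -dimv_eq0 dq.
have line (V : {vspace 'rV[K]_3}) :
    \dim V = 1%N -> vpick V != 0 -> V = <[vpick V]>%VS.
  move=> dV V0; apply/eqP; rewrite eq_sym eqEdim dV dim_vline V0 andbT.
  by rewrite -memvE memv_pick.
move=> /(cross_eq0_line p0)[x e].
have x0 : x != 0 by apply: contraNneq q0 => x0; rewrite e x0 scale0r.
rewrite eq_sym (line q dq q0) (line p dp p0) eqEdim !dim_vline p0 q0 andbT.
by rewrite -memvE e memvZ // memv_line.
Qed.

Section Bound.
Variables (K : numClosedFieldType) (d r : nat) (f : {mpoly K[3]}).
Local Notation S := {mpoly K[3]}.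
Hypotheses (fd : f \is d.+1.-homog) (fred : reduced f).
Variable rho : 'rV[S]_3.
Hypotheses (fr : is_mdr f r) (rho_r : AR f r%:Z rho) (rho0 : rho != 0).
Hypothesis le_rd : (r <= d)%N.

Lemma tjurina_conditions : exists ts : seq {vspace 'rV[K]_3},
  [/\ uniq ts, tjurina f = (\sum_(p <- ts) tjurina_at f (vpick p))%N
    & {in ts, forall p, \dim p = 1%N /\
        exists2 c : S -> 'rV[K]_(tjurina_at f (vpick p)),
          local_condition (vpick p) c & forall i m, c (m * f^`M(i)) = 0}].
Proof.
exists (finite_support 0%N (curve_points f) (fun p => tjurina_at f (vpick p))).
split=> [||p]; [exact: finite_support_uniq | by [] |].
(* If infinitely many points contributed, the support list would be empty and the finitely supported
   sum 0 by convention. *)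
have [fin|inf] := pselect (finite_set (curve_points f `&`
    (fun p => tjurina_at f (vpick p)) @^-1` [set~ 0%N])%classic); last first.
  by rewrite no_finite_support.
rewrite in_finite_support // inE => -[[dp _] /= tp].
split=> //; apply: (tjurina_local_condition _ fd).
  by rewrite vpick0 -dimv_eq0 dp.
(* Points of the support have a nonzero number, which rules out the default value 0 of [xget]. *)
by move: tp; rewrite /tjurina_at; case: xgetP.
Qed.

Lemma bin2E n : ('C(n + 2, n) * 2 = (n + 2) * (n + 1))%N.
Proof.
have -> : 'C(n + 2, n) = 'C(n.+2, 2) by rewrite -[RHS]bin_sub // addn2 subn2.
have := bin_ffact n.+2 2; rewrite !ffactnS ffactn0 muln1 => ->.
by rewrite addn2 addn1.
Qed.

(** [W] is cut out by the Tjurina conditions and contains the Jacobian ideal in degree [m + d]; [U]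
    consists of the forms vanishing on [zs] and contains all quotients [h]. Both codimensions are
    exact in large degree. *)
Lemma tjurina_zeros_bound (zs : seq 'rV[K]_3) : uniq zs ->
    {in zs, forall z, z != 0 /\ section_zero f rho z} ->
    {in zs &, forall z z', z != z' -> cross z z' != 0} ->
  ((size zs + tjurina f + r * (d - r)) <= d ^ 2)%N.
Proof.
move=> uz hz sz.
have [ts [ut -> tP]] := tjurina_conditions.
have [c cP] : exists c : forall p, S -> 'rV[K]_(tjurina_at f (vpick p)),
  {in ts, forall p, local_condition (vpick p) (@c p) /\
     forall i m, c p (m * f^`M(i)) = 0}.
  have ex p : exists c : S -> 'rV[K]_(tjurina_at f (vpick p)),
    p \in ts -> local_condition (vpick p) c /\ forall i m, c (m * f^`M(i)) = 0.
    have [/tP[_ [c h h']]|h] := boolP (p \in ts); first by exists c.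
    by exists (fun=> 0).
  by exists (fun p => projT1 (cid (ex p))) => p; exact: (projT2 (cid (ex p))).
have [||k1 k1P] := local_conditions_codim (p := fun p => vpick p) (c := c) ut.
- by move=> p /cP[].
- move=> p q /tP[dp _] /tP[dq _] pq.
  exact: separating_form (cross_vpick_neq0 dp dq pq).
have [||k2 k2P] := local_conditions_codim (p := id)
  (c := fun z m => const_mx (m.@[fun i => z 0 i]) : 'rV[K]_1) uz.
- by move=> z /hz[z0 _]; exact: eval_local_condition.
- move=> z z' zz zz' ne; exact: separating_form (sz _ _ zz zz' ne).
(* Large enough that [m + d >= k1], [m + r - d >= k2] and [m >= d]. *)
pose m := (d + k1 + k2)%N.
have [W dW WP] := k1P (m + d)%N ltac:(rewrite /m; lia).
have [U dU UP] := k2P (m + r - d)%N ltac:(rewrite /m; lia).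
have cnt := jacobian_count fd fred fr rho_r rho0 le_rd (W := W) (U := U).
have {}cnt : (3 * 'C(m + 2, m) <= \dim W + 'C(m - r + 2, m - r) + \dim U)%N.
  apply: cnt; first by rewrite /m; lia.
    move=> x hx h hE; apply/WP => p pt; have [[cl _ _ _] c0] := cP _ pt.
    have cD a b : c p (a + b) = c p a + c p b by have := cl 1 a b; rewrite !scale1r.
    by rewrite hE /dot sum3 !cD ![grad f _ _]mxE !c0 !addr0.
  move=> x xAR h hE; apply/UP => z /hz[_ z0]; apply/rowP => i.
  by rewrite !mxE; exact: z0 xAR hE.
rewrite big_const_seq count_predT iter_addn_0 mul1n in dU.
have B1 := bin2E m; have B2 := bin2E (m + d); have B3 := bin2E (m - r).
have B4 := bin2E (m + r - d).
move: dW dU cnt B1 B2 B3 B4.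
move: (\sum_(p <- ts) _)%N (size zs) (\dim W) (\dim U) => t s w u.
move: 'C(m + 2, m) 'C(m + d + 2, m + d) 'C(m - r + 2, m - r)
  'C(m + r - d + 2, m + r - d) => b1 b2 b3 b4.
(* Doubled, the binomial for [m + x] is m^2 + 3m + 2 + (2m + 3) x + x^2, with x = d, -r, -e. These
   sum to zero, so what remains is (d^2 + r^2 + e^2) / 2 = d^2 - r e. *)
have [e eE] : exists e, d = (e + r)%N by exists (d - r)%N; rewrite subnK.
have -> : (m - r = e + k1 + k2)%N by rewrite /m; lia.
have -> : (m + r - d = r + k1 + k2)%N by rewrite /m; lia.
have -> : (d - r = e)%N by lia.
rewrite /m eE -mulnn -!addnA; move: (k1 + k2)%N => N.
lia.
Qed.

End Bound.

Lemma dotC (R : comNzRingType) (x y : 'rV[R]_3) : dot x y = dot y x.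
Proof. by apply: eq_bigr => i _; rewrite mulrC. Qed.

Lemma dotZr (R : comNzRingType) (c : R) (x y : 'rV[R]_3) :
  dot x (c *: y) = c * dot x y.
Proof. by rewrite /dot !sum3 !mxE; ring. Qed.

Lemma cross_self (R : comNzRingType) (x : 'rV[R]_3) : cross x x = 0.
Proof. by apply/rowP; apply: forall3; rewrite !mxE /=; ring. Qed.

Lemma cross_anti (R : comNzRingType) (x y : 'rV[R]_3) : cross x y = - cross y x.
Proof. by apply/rowP; apply: forall3; rewrite !mxE /=; ring. Qed.

Section FiniteZeros.
Variables (K : numClosedFieldType) (d r : nat) (f : {mpoly K[3]}).
Local Notation S := {mpoly K[3]}.
Hypotheses (fd : f \is d.+1.-homog) (fred : reduced f).
Variable rho : 'rV[S]_3.
Hypotheses (fr : is_mdr f r) (rho_r : AR f r%:Z rho) (rho0 : rho != 0).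
Hypothesis le_rd : (r <= d)%N.

(** Families of pairwise nonproportional zeros have bounded size; a zero proportional to no member
    of a largest family could be added to it. *)
Lemma zeros_representatives : exists zs : seq 'rV[K]_3,
  [/\ ((size zs + tjurina f + r * (d - r)) <= d ^ 2)%N,
      {in zs, forall z, z != 0}
    & forall p, p != 0 -> section_zero f rho p ->
        exists2 z, z \in zs & exists2 c, c != 0 & p = c *: z].
Proof.
pose good (zs : seq 'rV[K]_3) := [/\ uniq zs,
  {in zs, forall z, z != 0 /\ section_zero f rho z}
  & {in zs &, forall z z', z != z' -> cross z z' != 0}].
pose has_size n := `[< exists2 zs, good zs & size zs = n >].
have bound zs : good zs -> ((size zs + tjurina f + r * (d - r)) <= d ^ 2)%N.
  by move=> [uz hz sz]; exact: tjurina_zeros_bound uz hz sz.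
have ex0 : exists n, has_size n by exists 0%N; apply/asboolP; exists [::].
have ub n : has_size n -> (n <= d ^ 2)%N.
  move=> /asboolP[zs /bound h <-]; apply: leq_trans h.
  by rewrite -addnA leq_addr.
case: (ex_maxnP ex0 ub) => n /asboolP[zs gzs <-] nmax.
have [uz hz sz] := gzs; exists zs; split; first exact: bound.
  by move=> z /hz[].
move=> p p0 pz; apply: contrapT => hN.
have indep z : z \in zs -> cross z p != 0.
  move=> zzs; apply/eqP => /(cross_eq0_line (hz _ zzs).1)[c e].
  apply: hN; exists z => //; exists c => //.
  by apply: contraNneq p0 => c0; rewrite e c0 scale0r.
have : has_size (size (p :: zs)).
  apply/asboolP; exists (p :: zs) => //; split.
  - rewrite /= uz andbT; apply/negP => /indep.
    by rewrite cross_self eqxx.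
  - by move=> z; rewrite inE => /orP[/eqP->|/hz].
  move=> z z'; rewrite !inE => /orP[/eqP->|zz] /orP[/eqP->|zz'].
  - by rewrite eqxx.
  - by move=> _; rewrite cross_anti oppr_eq0 indep.
  - by move=> _; rewrite indep.
  - exact: sz.
by move=> /nmax /=; rewrite ltnn.
Qed.

Hypothesis le_2r : (2 * r <= d.+1)%N.

Lemma generic_line (h : S) (zs : seq 'rV[K]_3) : h != 0 ->
  {in zs, forall z, z != 0} ->
  exists a : 'rV[K]_3, [/\ a != 0, h.@[fun i => a 0 i] != 0
    & {in zs, forall z, dot z a != 0}].
Proof.
move=> h0 zs0.
have lf (z : 'rV[K]_3) : z != 0 -> line_form z != 0.
  move=> z0; have [i zi] : exists i, z 0 i != 0.
    apply/existsP; rewrite -negb_forall; apply: contra z0 => /forallP hz.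
    by apply/eqP/rowP => i; rewrite (eqP (hz i)) mxE.
  apply: (@line_form_neq0 _ _ (\row_j (j == i)%:R)).
  rewrite /dot (bigD1 i) //= mxE eqxx mulr1 big1 ?addr0 // => j /negbTE ji.
  by rewrite mxE ji mulr0.
(* The factor ['X_ord0] ensures that the vector found is nonzero, even when [h] is constant. *)
have : h * 'X_ord0 * \prod_(z <- zs) line_form z != 0.
  rewrite mulf_neq0 //; last first.
    by rewrite prodf_seq_neq0; apply/allP => z /zs0 /lf.
  by rewrite mulf_neq0 // -msize_poly_eq0 msizeX.
move=> /mpoly_nonvanishing[x].
rewrite !mevalM !mulf_eq0 !negb_or mevalXU => /andP[/andP[hx x0] zx].
exists (\row_i x i).
have xE p : p.@[fun i => (\row_i x i) 0 i] = p.@[x].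
  by apply: meval_eq => i; rewrite mxE.
split; last 1 first.
- move=> z zzs; rewrite -line_form_eval xE; move: zx.
  by rewrite rmorph_prod prodf_seq_neq0 => /allP/(_ z zzs).
- by apply: contraNneq x0 => /rowP/(_ ord0); rewrite !mxE => ->.
by rewrite xE.
Qed.

(** A line through none of the [zs] and a suitable generic line both have [d1 = min (r, d - r)], so
    the former is not jumping. *)
Lemma jumping_lines_cover : exists zs : seq 'rV[K]_3,
  [/\ ((size zs + tjurina f + r * (d - r)) <= d ^ 2)%N,
      {in zs, forall z, z != 0}
    & forall a, a != 0 -> jumping_line f a -> exists2 z, z \in zs & dot z a = 0].
Proof.
have [zs [szs zs0 cover]] := zeros_representatives.
exists zs; split=> // a a0 [d1 [d2 [e1 [e2 [sta [h [h0 _ hgen]] jump]]]]].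
apply: contrapT => hN.
have avoid b : {in zs, forall z, dot z b != 0} ->
    forall p, p != 0 -> dot b p = 0 -> ~ section_zero f rho p.
  move=> hb p p0 bp /(cover p p0)[z zzs [c c0 pE]].
  move/eqP: bp; rewrite pE dotZr mulf_eq0 (negbTE c0) /= dotC.
  by rewrite (negbTE (hb z zzs)).
have [b [b0 hb bzs]] := generic_line h0 zs0.
have e1E := splitting_type_avoid fd fred fr rho_r rho0 le_2r b0 (avoid b bzs)
  (hgen b b0 hb).
have d1E : d1 = Num.min r%:Z (d%:Z - r%:Z).
  apply: (splitting_type_avoid fd fred fr rho_r rho0 le_2r a0 _ sta).
  by apply: avoid => z zzs; apply/eqP => za; apply: hN; exists z.
by move: jump; rewrite e1E d1E subrr ltxx.
Qed.

End FiniteZeros.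

Theorem corollary5p5 (R : realType) (d r : nat) (f : {mpoly R[i][3]}) :
  f \is d.-homog -> reduced f ->
  is_mdr f r -> (1 <= r)%N -> (2 * r <= d)%N ->
  exists lines : seq 'rV[R[i]]_3,
    [/\ (size lines)%:Z <=
          (d%:Z - 1) ^+ 2 - r%:Z * (d%:Z - r%:Z - 1) - (tjurina f)%:Z,
        forall u, u \in lines -> u != 0
      & forall a : 'rV[R[i]]_3, a != 0 -> jumping_line f a ->
          exists2 u, u \in lines & \sum_(i < 3) u 0 i * a 0 i = 0].
Proof.
case: d => [|d] fd fred fr r1 le_2r; first by lia.
have [[rho rho_r rho0] _] := fr.
have le_rd : (r <= d)%N by lia.
have [zs [szs zs0 cover]] := jumping_lines_cover fd fred fr rho_r rho0 le_rd le_2r.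
exists zs; split=> //.
have -> : d.+1%:Z - 1 = d%:Z by lia.
have -> : d.+1%:Z - r%:Z - 1 = (d - r)%N%:Z by lia.
move: szs; rewrite -mulnn expr2; move: (d - r)%N (tjurina f) (size zs) => e t s.
by lia.
Qed.
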